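(* Let $-\pi/2<\alpha<\pi/2$ and $\lambda<1$. For every $f\in\mathcal{S}^*_\alpha(\lambda)$, $\|J[f]\|\le 4(1-\lambda)\cos\alpha$, and this inequality is sharp: equality holds for some $f\in\mathcal{S}^*_\alpha(\lambda)$.
   Context: $\mathbb{D}$ is the open unit disk; $\mathcal{A}$ the class of analytic $f$ on $\mathbb{D}$ with $f(0)=0$, $f'(0)=1$. For $\alpha\in(-\pi/2,\pi/2)$, $\lambda<1$, $\mathcal{S}^*_\alpha(\lambda)=\{f\in\mathcal{A}: f(z)\neq0 \text{ for } z\ne 0,\ \mathrm{Re}\,(e^{i\alpha}zf'(z)/f(z))>\lambda\cos\alpha \text{ on }\mathbb{D}\}$. The Alexander transform is $J[f](z)=\int_0^z f(w)/w\,dw$. For $h\in\mathcal{A}$ with $h'$ nonvanishing on $\mathbb{D}$, the pre-Schwarzian norm is $\|h\|=\sup_{z\in\mathbb{D}}(1-|z|^2)|h''(z)/h'(z)|$. *)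

(* Defs.v *)
From Stdlib Require Import Reals ClassicalEpsilon.
From Coquelicot Require Export Coquelicot.
Open Scope R_scope.

Definition in_disk (z : C) : Prop := Cmod z < 1.

(* complex derivative (a chosen value; meaningful where f is complex-differentiable) *)
Definition Cderiv (f : C -> C) (z : C) : C :=
  epsilon (inhabits (RtoC 0)) (fun l : C => is_derive (K := C_AbsRing) (V := C_NormedModule) f z l).

Definition analytic_on_disk (f : C -> C) : Prop :=
  forall z : C, in_disk z -> ex_derive (K := C_AbsRing) (V := C_NormedModule) f z.

Definition classA (f : C -> C) : Prop :=
  analytic_on_disk f /\ f (RtoC 0) = RtoC 0 /\ Cderiv f (RtoC 0) = RtoC 1.

Definition cexpi (a : R) : C := (cos a, sin a).

(* S*_alpha(lambda); the quantity z f'(z)/f(z) is taken at z <> 0 (at z = 0 it is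
   the removable value 1, for which the inequality cos a > lam cos a holds anyway) *)
Definition Sstar (alpha lam : R) (f : C -> C) : Prop :=
  classA f /\
  (forall z : C, in_disk z -> z <> RtoC 0 -> f z <> RtoC 0) /\
  (forall z : C, in_disk z -> z <> RtoC 0 ->
     Re (Cmult (cexpi alpha) (Cdiv (Cmult z (Cderiv f z)) (f z))) > lam * cos alpha).

(* Alexander transform J[f](z) = int_0^z f(w)/w dw, along the segment w = t z, t in [0,1] *)
Definition alexander (f : C -> C) (z : C) : C :=
  RInt (V := C_R_CompleteNormedModule)
       (fun t : R => Cmult (Cdiv (f (Cmult (RtoC t) z)) (Cmult (RtoC t) z)) z) 0 1.

Definition preschwarzian_norm (h : C -> C) : Rbar :=
  Lub_Rbar (fun r : R => exists z : C, in_disk z /\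
     r = (1 - Cmod z ^ 2) * Cmod (Cdiv (Cderiv (Cderiv h) z) (Cderiv h z))).

(* Main.v *)
Require Import Defs.
From Stdlib Require Import Reals Lra Lia ClassicalEpsilon.
From Coquelicot Require Import Coquelicot.
Open Scope R_scope.

(** Write [f z = z * g z]. Then [J[f]' = g], so the pre-Schwarzian derivative of [J[f]] is
    [q = g' / g], and [z f' / f = 1 + z q]. With [b = (1 - lam) cos alpha] and
    [s = e^(i alpha) q], spirallikeness reads [Re (z s) > - b]; Schwarz's lemma applied to
    [z s / (2 b + z s)] gives [|s| (1 - |z|) <= 2 b], hence
    [(1 - |z|^2) |q| <= 2 b (1 + |z|) < 4 b]. The bound is approached along [z -> 1] for
    [g = (1 - z)^(- 2 b e^(- i alpha))], for which [s = 2 b / (1 - z)].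

    Holomorphy is only assumed as pointwise complex differentiability. Goursat's theorem yields
    primitives on discs, even for a continuous function that is holomorphic off one point. Applied
    to the slope [(f z - f a) / (z - a)] this gives Cauchy's formula; differentiating it under the
    integral shows that [f'] is holomorphic, and that a continuous function which is holomorphic
    off one point, being the derivative of its primitive, is holomorphic. *)

(** * Continuity and derivatives of complex-valued functions *)

(* Coquelicot states the product and chain rules for functions into the absolute ring itself, so
   complex functions are taken into [CV] and not into [C_NormedModule]. The domain of a function
   of a complex variable would be inferred as [C_UniformSpace]; it has to be given as [CU]. *)
Notation CU := (AbsRing_UniformSpace C_AbsRing).
Notation CV := (AbsRing_NormedModule C_AbsRing).
Notation is_C_derive := (is_derive (K := C_AbsRing) (V := CV)).
Notation is_curve_derive := (is_derive (K := R_AbsRing) (V := C_R_NormedModule)).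
Notation C_continuous f x := (@continuous _ CU f x).

Lemma Cmod_minus_sym (a b : C) : Cmod (a - b)%C = Cmod (b - a)%C.
Proof. rewrite <- Cmod_opp. f_equal. ring. Qed.

Lemma Cmod_minus_triangle (a b c : C) : Cmod (a - c)%C <= Cmod (a - b)%C + Cmod (b - c)%C.
Proof. replace (a - c)%C with ((a - b) + (b - c))%C by ring. apply Cmod_triangle. Qed.

Lemma Cmod_triangle_rev (a b : C) : Cmod a - Cmod b <= Cmod (a - b)%C.
Proof.
  generalize (Cmod_triangle (a - b)%C b). replace (a - b + b)%C with a by ring. lra.
Qed.

Lemma im_le_Cmod (z : C) : Rabs (Im z) <= Cmod z.
Proof. eapply Rle_trans; [apply Rmax_r|apply Rmax_Cmod]. Qed.

Lemma C_eq_Re_Im (z : C) : z = (RtoC (Re z) + Ci * RtoC (Im z))%C.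
Proof. destruct z as [x y]. unfold RtoC, Ci, Cplus, Cmult. simpl. f_equal; ring. Qed.

Lemma is_derive_iff_norm {K : AbsRing} {V : NormedModule K} (f : K -> V) (x : K) (l : V) :
  is_derive f x l <->
  forall eps : posreal, locally x (fun y =>
    norm (minus (minus (f y) (f x)) (scal (minus y x) l)) <= eps * norm (minus y x)).
Proof.
  split.
  - intros [_ H]. exact (H x (fun P HP => HP)).
  - intros H. split; [apply is_linear_scal_l|]. intros y Hy.
    rewrite <- (is_filter_lim_locally_unique (V := AbsRing_NormedModule K) x y Hy). exact H.
Qed.

Lemma is_C_derive_iff (f : C -> C) (z l : C) :
  is_C_derive f z l <->
  forall eps : posreal, locally (T := CU) z (fun w =>
    Cmod (f w - f z - (w - z) * l)%C <= eps * Cmod (w - z)%C).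
Proof. exact (is_derive_iff_norm (V := CV) f z l). Qed.

Lemma is_C_derive_NormedModule (f : C -> C) (z l : C) :
  is_derive (K := C_AbsRing) (V := C_NormedModule) f z l <-> is_C_derive f z l.
Proof. rewrite is_C_derive_iff. exact (is_derive_iff_norm (V := C_NormedModule) f z l). Qed.

Lemma is_curve_derive_iff (u : R -> C) (t : R) (l : C) :
  is_curve_derive u t l <->
  forall eps : posreal, locally t (fun s =>
    Cmod (u s - u t - (RtoC s - RtoC t) * l)%C <= eps * Cmod (RtoC s - RtoC t)%C).
Proof.
  rewrite is_derive_iff_norm.
  split; intros H eps; generalize (H eps); apply filter_imp; intros s;
    rewrite <- RtoC_minus, Cmod_R, <- scal_R_Cmult, Cmod_norm; intros Hs; exact Hs.
Qed.

Lemma C_continuous_iff {T : UniformSpace} (f : T -> C) (x : T) :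
  C_continuous f x <-> forall eps : posreal, locally x (fun y => Cmod (f y - f x)%C < eps).
Proof. exact (filterlim_locally (U := CU) f (f x)). Qed.

Lemma C_continuous_prod {T : UniformSpace} (f : T -> C) (x : T) :
  C_continuous f x <-> @continuous T C_R_NormedModule f x.
Proof. split; intros H P HP; apply (H P); now apply locally_C. Qed.

Lemma C_continuous_minus {T : UniformSpace} (f g : T -> C) (x : T) :
  C_continuous f x -> C_continuous g x -> C_continuous (fun t => f t - g t)%C x.
Proof. exact (continuous_minus (V := CV) f g x). Qed.

Lemma C_continuous_mult {T : UniformSpace} (f g : T -> C) (x : T) :
  C_continuous f x -> C_continuous g x -> C_continuous (fun t => f t * g t)%C x.
Proof. exact (continuous_mult (K := C_AbsRing) f g x). Qed.

Lemma C_continuous_const {T : UniformSpace} (c : C) (x : T) : C_continuous (fun _ => c) x.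
Proof. apply continuous_const. Qed.

Lemma C_continuous_comp {T : UniformSpace} (f : C -> C) (g : T -> C) (x : T) :
  C_continuous g x -> @continuous CU CU f (g x) -> C_continuous (fun t => f (g t)) x.
Proof. exact (@continuous_comp T CU CU g f x). Qed.

Lemma C_continuous_pow {T : UniformSpace} (f : T -> C) (m : nat) (x : T) :
  C_continuous f x -> C_continuous (fun t => f t ^ m)%C x.
Proof.
  intros Hf. induction m; simpl; [apply C_continuous_const|now apply C_continuous_mult].
Qed.

Lemma Cinv_continuous (z : C) : z <> RtoC 0 -> @continuous CU CU Cinv z.
Proof.
  intros Hz. assert (Hm : 0 < Cmod z) by now apply Cmod_gt_0.
  apply C_continuous_iff. intros eps.
  set (delta := Rmin (Cmod z / 2) (eps * (Cmod z ^ 2 / 2))).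
  assert (Hdelta : 0 < delta).
  { assert (0 < Cmod z ^ 2) by now apply pow_lt.
    apply Rmin_pos; [lra|]. apply Rmult_lt_0_compat; [apply cond_pos|lra]. }
  exists (mkposreal delta Hdelta). intros w Hw. change (Cmod (w - z)%C < delta) in Hw.
  assert (Hnear := Rlt_le_trans _ _ _ Hw (Rmin_l _ _)).
  assert (Hsmall := Rlt_le_trans _ _ _ Hw (Rmin_r _ _)).
  assert (Hwm : Cmod z / 2 < Cmod w).
  { generalize (Cmod_triangle_rev z w). rewrite Cmod_minus_sym. lra. }
  assert (Nw : w <> RtoC 0) by (apply Cmod_gt_0; lra).
  replace (/ w - / z)%C with (- ((w - z) / (w * z)))%C by (field; auto).
  rewrite Cmod_opp, Cmod_div, Cmod_mult by now apply Cmult_neq_0.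
  apply Rlt_div_l; [apply Rmult_lt_0_compat; lra|].
  eapply Rlt_le_trans; [exact Hsmall|].
  apply Rmult_le_compat_l; [left; apply cond_pos|]. simpl. nra.
Qed.

Lemma C_continuous_inv {T : UniformSpace} (f : T -> C) (x : T) :
  C_continuous f x -> f x <> RtoC 0 -> C_continuous (fun t => / f t)%C x.
Proof. intros Hf Nf. apply C_continuous_comp; [exact Hf|now apply Cinv_continuous]. Qed.

Lemma C_continuous_Re {T : UniformSpace} (f : T -> C) (x : T) :
  C_continuous f x -> continuous (fun t => Re (f t)) x.
Proof.
  intros Hf. apply (filterlim_locally (fun t => Re (f t)) (Re (f x))). intros eps.
  generalize (proj1 (C_continuous_iff f x) Hf eps). apply filter_imp. intros y Hy.
  eapply Rle_lt_trans; [|exact Hy]. exact (re_le_Cmod (f y - f x)%C).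
Qed.

Lemma C_continuous_Im {T : UniformSpace} (f : T -> C) (x : T) :
  C_continuous f x -> continuous (fun t => Im (f t)) x.
Proof.
  intros Hf. apply (filterlim_locally (fun t => Im (f t)) (Im (f x))). intros eps.
  generalize (proj1 (C_continuous_iff f x) Hf eps). apply filter_imp. intros y Hy.
  eapply Rle_lt_trans; [|exact Hy]. exact (im_le_Cmod (f y - f x)%C).
Qed.

Lemma is_C_derive_eq (f : C -> C) (z l l' : C) : is_C_derive f z l -> l = l' -> is_C_derive f z l'.
Proof. now intros H <-. Qed.

Lemma is_C_derive_ext_loc (f g : C -> C) (z l : C) :
  locally (T := CU) z (fun w => f w = g w) -> is_C_derive f z l -> is_C_derive g z l.
Proof. exact (is_derive_ext_loc (V := CV) f g z l). Qed.

Lemma is_C_derive_Cderiv (f : C -> C) (z l : C) : is_C_derive f z l -> Cderiv f z = l.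
Proof.
  intros H. apply is_C_derive_NormedModule in H.
  rewrite <- (is_C_derive_unique f z l H). symmetry. apply is_C_derive_unique.
  unfold Cderiv. apply epsilon_spec. now exists l.
Qed.

Lemma is_C_derive_continuous (f : C -> C) (z l : C) : is_C_derive f z l -> @continuous CU CU f z.
Proof. intros H. apply (ex_derive_continuous (K := C_AbsRing) (V := CV)). now exists l. Qed.

Lemma is_curve_derive_continuous (u : R -> C) (t : R) (l : C) :
  is_curve_derive u t l -> C_continuous u t.
Proof.
  intros H. apply C_continuous_prod.
  apply (ex_derive_continuous (K := R_AbsRing) (V := C_R_NormedModule)). now exists l.
Qed.

Lemma is_C_derive_const (c z : C) : is_C_derive (fun _ => c) z (RtoC 0).
Proof. exact (is_derive_const (V := CV) c z). Qed.

Lemma is_C_derive_id (z : C) : is_C_derive (fun w => w) z (RtoC 1).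
Proof. exact (is_derive_id z). Qed.

Lemma is_C_derive_plus (f g : C -> C) (z a b : C) :
  is_C_derive f z a -> is_C_derive g z b -> is_C_derive (fun w => f w + g w)%C z (a + b)%C.
Proof. exact (is_derive_plus (V := CV) f g z a b). Qed.

Lemma is_C_derive_minus (f g : C -> C) (z a b : C) :
  is_C_derive f z a -> is_C_derive g z b -> is_C_derive (fun w => f w - g w)%C z (a - b)%C.
Proof. exact (is_derive_minus (V := CV) f g z a b). Qed.

Lemma is_C_derive_mult (f g : C -> C) (z a b : C) :
  is_C_derive f z a -> is_C_derive g z b ->
  is_C_derive (fun w => f w * g w)%C z (a * g z + f z * b)%C.
Proof. intros Hf Hg. exact (is_derive_mult f g z a b Hf Hg Cmult_comm). Qed.

Lemma is_C_derive_scal (c : C) (f : C -> C) (z l : C) :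
  is_C_derive f z l -> is_C_derive (fun w => c * f w)%C z (c * l)%C.
Proof.
  intros Hf. eapply is_C_derive_eq.
  - apply is_C_derive_mult; [apply is_C_derive_const|exact Hf].
  - cbv beta; ring.
Qed.

Lemma is_C_derive_minus_const (c z : C) : is_C_derive (fun w => w - c)%C z (RtoC 1).
Proof.
  eapply is_C_derive_eq.
  - apply is_C_derive_minus; [apply is_C_derive_id|apply is_C_derive_const].
  - ring.
Qed.

Lemma is_C_derive_comp (f g : C -> C) (z a b : C) :
  is_C_derive f (g z) a -> is_C_derive g z b -> is_C_derive (fun w => f (g w)) z (a * b)%C.
Proof. intros Hf Hg. rewrite Cmult_comm. exact (is_derive_comp (V := CV) f g z a b Hf Hg). Qed.

Lemma locally_Cneq (z a : C) : z <> a -> locally (T := CU) z (fun w => w <> a).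
Proof.
  intros Hz. assert (Hd : 0 < Cmod (z - a)%C) by now apply Cmod_gt_0, Cminus_eq_contra.
  exists (mkposreal _ Hd). intros w Hw ->. apply (Rlt_irrefl (Cmod (z - a)%C)).
  rewrite Cmod_minus_sym at 1. exact Hw.
Qed.

Lemma is_C_derive_Cinv (z : C) : z <> RtoC 0 -> is_C_derive Cinv z (- (/ z * / z))%C.
Proof.
  intros Hz. assert (Hm : 0 < Cmod z) by now apply Cmod_gt_0.
  apply is_C_derive_iff. intros eps.
  assert (He : 0 < eps * Cmod z) by (apply Rmult_lt_0_compat; [apply cond_pos|exact Hm]).
  generalize (filter_and _ _ (locally_Cneq z (RtoC 0) Hz)
    (proj1 (C_continuous_iff (T := CU) Cinv z) (Cinv_continuous z Hz) (mkposreal _ He))).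
  apply filter_imp. intros w [Nw Hw]. simpl in Hw.
  replace (/ w - / z - (w - z) * - (/ z * / z))%C
    with (- ((w - z) * ((/ w - / z) * / z)))%C by (field; auto).
  rewrite Cmod_opp, !Cmod_mult, Rmult_comm, (Cmod_inv z) by auto.
  apply Rmult_le_compat_r; [apply Cmod_ge_0|]. left. now apply Rlt_div_l.
Qed.

Lemma is_C_derive_inv (f : C -> C) (z a : C) :
  is_C_derive f z a -> f z <> RtoC 0 -> is_C_derive (fun w => / f w)%C z (- a / (f z * f z))%C.
Proof.
  intros Hf Nf. eapply is_C_derive_eq.
  - apply (is_C_derive_comp Cinv f); [now apply is_C_derive_Cinv|exact Hf].
  - field; auto.
Qed.

(* Caratheodory's form of differentiability with respect to the coordinate [j]: it turns the chain
   rule into a composition of continuous functions. *)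
Definition has_slope {T : UniformSpace} (j f : T -> C) (x : T) (l : C) : Prop :=
  exists phi : T -> C, C_continuous phi x /\ phi x = l /\
    forall y, f y = (f x + (j y - j x) * phi y)%C.

Lemma has_slope_iff {T : UniformSpace} (j f : T -> C) (x : T) (l : C) :
  (forall y, j y = j x -> y = x) ->
  has_slope j f x l <->
  forall eps : posreal, locally x (fun y =>
    Cmod (f y - f x - (j y - j x) * l)%C <= eps * Cmod (j y - j x)%C).
Proof.
  intros Hj. split.
  - intros [phi [Hphi [<- Hf]]] eps.
    generalize (proj1 (C_continuous_iff phi x) Hphi eps). apply filter_imp. intros y Hy.
    rewrite (Hf y).
    replace (f x + (j y - j x) * phi y - f x - (j y - j x) * phi x)%C
      with ((phi y - phi x) * (j y - j x))%C by ring.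
    rewrite Cmod_mult. apply Rmult_le_compat_r; [apply Cmod_ge_0|lra].
  - intros H.
    exists (fun y => if Ceq_dec (j y) (j x) then l else (f y - f x) / (j y - j x))%C.
    destruct (Ceq_dec (j x) (j x)) as [_|[]]; [|reflexivity]. repeat split.
    + apply C_continuous_iff. intros eps.
      destruct (Ceq_dec (j x) (j x)) as [_|[]]; [|reflexivity].
      assert (He : 0 < eps / 2) by (generalize (cond_pos eps); lra).
      generalize (H (mkposreal _ He)). apply filter_imp. simpl. intros y Hy.
      destruct (Ceq_dec (j y) (j x)) as [_|Ny].
      * replace (l - l)%C with (RtoC 0) by ring. rewrite Cmod_0. apply cond_pos.
      * assert (N : (j y - j x)%C <> RtoC 0) by now apply Cminus_eq_contra.
        replace ((f y - f x) / (j y - j x) - l)%C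
          with ((f y - f x - (j y - j x) * l) / (j y - j x))%C by (field; exact N).
        rewrite Cmod_div by exact N.
        apply Rle_lt_trans with (eps / 2); [|generalize (cond_pos eps); lra].
        apply Rle_div_l; [now apply Cmod_gt_0|exact Hy].
    + intros y. destruct (Ceq_dec (j y) (j x)) as [E|Ny].
      * rewrite (Hj y E). ring.
      * field. now apply Cminus_eq_contra.
Qed.

Lemma is_C_derive_slope (f : C -> C) (z l : C) :
  is_C_derive f z l <-> has_slope (T := CU) (fun w => w) f z l.
Proof. now rewrite is_C_derive_iff, has_slope_iff. Qed.

Lemma is_curve_derive_slope (u : R -> C) (t : R) (l : C) :
  is_curve_derive u t l <-> has_slope RtoC u t l.
Proof. rewrite is_curve_derive_iff, has_slope_iff; [reflexivity|]. intros s. apply RtoC_inj. Qed.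

Lemma is_curve_derive_comp (f : C -> C) (u : R -> C) (t : R) (l d : C) :
  is_C_derive f (u t) l -> is_curve_derive u t d -> is_curve_derive (fun s => f (u s)) t (l * d)%C.
Proof.
  intros Hf Hu. assert (Cu := is_curve_derive_continuous u t d Hu).
  apply is_C_derive_slope in Hf. apply is_curve_derive_slope in Hu. apply is_curve_derive_slope.
  destruct Hf as [phi [Cphi [<- Ef]]], Hu as [psi [Cpsi [<- Eu]]].
  exists (fun s => phi (u s) * psi s)%C. repeat split.
  - apply C_continuous_mult; [now apply C_continuous_comp|exact Cpsi].
  - intros s. rewrite (Ef (u s)), (Eu s) at 1. ring.
Qed.

Lemma is_curve_derive_eq (u : R -> C) (t : R) (l l' : C) :
  is_curve_derive u t l -> l = l' -> is_curve_derive u t l'.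
Proof. now intros H <-. Qed.

Lemma is_curve_derive_pair (u v : R -> R) (t a b : R) :
  is_derive u t a -> is_derive v t b -> is_curve_derive (fun s => (u s, v s)) t (a, b).
Proof.
  intros Hu Hv.
  apply (filterdiff_comp'_2 (V := R_NormedModule) (W := C_R_NormedModule)
    u v pair t (fun s => scal s a) (fun s => scal s b) pair); [exact Hu|exact Hv|].
  apply (filterdiff_ext (fun p : C_R_NormedModule => p)); [now intros []|].
  apply filterdiff_ext_lin with (fun p : C_R_NormedModule => p); [|now intros []].
  apply filterdiff_id.
Qed.

Definition holomorphic_on (D : C -> Prop) (f : C -> C) : Prop :=
  forall z, D z -> exists l, is_C_derive f z l.

Definition C_continuous_on (D : C -> Prop) (f : C -> C) : Prop :=
  forall z, D z -> @continuous CU CU f z.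

Lemma holomorphic_on_continuous (D : C -> Prop) (f : C -> C) :
  holomorphic_on D f -> C_continuous_on D f.
Proof. intros Hf z Hz. destruct (Hf z Hz) as [l Hl]. exact (is_C_derive_continuous f z l Hl). Qed.

Lemma holomorphic_on_Cderiv (D : C -> Prop) (f : C -> C) (z : C) :
  holomorphic_on D f -> D z -> is_C_derive f z (Cderiv f z).
Proof. intros Hf Hz. destruct (Hf z Hz) as [l Hl]. now rewrite (is_C_derive_Cderiv f z l Hl). Qed.

Lemma holomorphic_on_subset (D E : C -> Prop) (f : C -> C) :
  (forall z, E z -> D z) -> holomorphic_on D f -> holomorphic_on E f.
Proof. intros HE Hf z Hz. apply Hf. now apply HE. Qed.

Lemma holomorphic_on_const (D : C -> Prop) (c : C) : holomorphic_on D (fun _ => c).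
Proof. intros z _. exists (RtoC 0). apply is_C_derive_const. Qed.

Lemma holomorphic_on_id (D : C -> Prop) : holomorphic_on D (fun z => z).
Proof. intros z _. exists (RtoC 1). apply is_C_derive_id. Qed.

Lemma holomorphic_on_plus (D : C -> Prop) (f g : C -> C) :
  holomorphic_on D f -> holomorphic_on D g -> holomorphic_on D (fun z => f z + g z)%C.
Proof.
  intros Hf Hg z Hz. destruct (Hf z Hz) as [a Ha], (Hg z Hz) as [b Hb].
  exists (a + b)%C. now apply is_C_derive_plus.
Qed.

Lemma holomorphic_on_mult (D : C -> Prop) (f g : C -> C) :
  holomorphic_on D f -> holomorphic_on D g -> holomorphic_on D (fun z => f z * g z)%C.
Proof.
  intros Hf Hg z Hz. destruct (Hf z Hz) as [a Ha], (Hg z Hz) as [b Hb].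
  exists (a * g z + f z * b)%C. now apply is_C_derive_mult.
Qed.

Lemma holomorphic_on_inv (D : C -> Prop) (f : C -> C) :
  holomorphic_on D f -> (forall z, D z -> f z <> RtoC 0) -> holomorphic_on D (fun z => / f z)%C.
Proof.
  intros Hf Nf z Hz. destruct (Hf z Hz) as [a Ha].
  exists (- a / (f z * f z))%C. apply is_C_derive_inv; auto.
Qed.

Lemma holomorphic_on_pow (D : C -> Prop) (f : C -> C) (n : nat) :
  holomorphic_on D f -> holomorphic_on D (fun z => f z ^ n)%C.
Proof.
  intros Hf. induction n; simpl; [apply holomorphic_on_const|now apply holomorphic_on_mult].
Qed.

(** * Integrals along curves and segments *)

Notation C_RInt := (RInt (V := C_R_CompleteNormedModule)).
Notation is_C_RInt := (is_RInt (V := C_R_NormedModule)).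

Lemma is_C_RInt_unique (u : R -> C) (a b : R) (I : C) : is_C_RInt u a b I -> C_RInt u a b = I.
Proof. apply (is_RInt_unique (V := C_R_CompleteNormedModule)). Qed.

Lemma C_RInt_correct (u : R -> C) (a b : R) :
  (forall t, Rmin a b <= t <= Rmax a b -> C_continuous u t) -> is_C_RInt u a b (C_RInt u a b).
Proof.
  intros Hu. apply (RInt_correct (V := C_R_CompleteNormedModule)).
  apply (ex_RInt_continuous (V := C_R_CompleteNormedModule)).
  intros t Ht. now apply C_continuous_prod, Hu.
Qed.

Lemma C_RInt_ext (u v : R -> C) (a b : R) :
  (forall t, Rmin a b < t < Rmax a b -> u t = v t) -> C_RInt u a b = C_RInt v a b.
Proof. apply (RInt_ext (V := C_R_CompleteNormedModule)). Qed.

Lemma is_C_RInt_ext (u v : R -> C) (a b : R) (I : C) :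
  (forall t, Rmin a b < t < Rmax a b -> u t = v t) -> is_C_RInt u a b I -> is_C_RInt v a b I.
Proof. apply (is_RInt_ext (V := C_R_NormedModule)). Qed.

Lemma C_RInt_const (c : C) (a b : R) : C_RInt (fun _ => c) a b = (RtoC (b - a) * c)%C.
Proof. now rewrite (RInt_const (V := C_R_CompleteNormedModule)), scal_R_Cmult. Qed.

Lemma is_C_RInt_minus (u v : R -> C) (a b : R) (I J : C) :
  is_C_RInt u a b I -> is_C_RInt v a b J -> is_C_RInt (fun t => u t - v t)%C a b (I - J)%C.
Proof. exact (is_RInt_minus (V := C_R_NormedModule) u v a b I J). Qed.

Lemma is_C_RInt_scal (c : C) (u : R -> C) (a b : R) (I : C) :
  is_C_RInt u a b I -> is_C_RInt (fun t => c * u t)%C a b (c * I)%C.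
Proof.
  intros HI.
  assert (HRe := is_RInt_fct_extend_fst (U := R_NormedModule) (V := R_NormedModule) u a b I HI).
  assert (HIm := is_RInt_fct_extend_snd (U := R_NormedModule) (V := R_NormedModule) u a b I HI).
  apply (is_RInt_fct_extend_pair (U := R_NormedModule) (V := R_NormedModule)); simpl.
  - apply (is_RInt_minus (V := R_NormedModule)
      (fun t => fst c * fst (u t)) (fun t => snd c * snd (u t)));
      now apply (is_RInt_scal (V := R_NormedModule)).
  - apply (is_RInt_plus (V := R_NormedModule)
      (fun t => fst c * snd (u t)) (fun t => snd c * fst (u t)));
      now apply (is_RInt_scal (V := R_NormedModule)).
Qed.

Lemma is_C_RInt_norm_le (u : R -> C) (a b : R) (I : C) (M : R) :
  a <= b -> (forall t, a <= t <= b -> Cmod (u t) <= M) -> is_C_RInt u a b I ->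
  Cmod I <= (b - a) * M.
Proof.
  intros Hab HM HI. rewrite Cmod_norm.
  apply (norm_RInt_le_const (V := C_R_NormedModule) u a b I M Hab); [|exact HI].
  intros t Ht. rewrite <- Cmod_norm. now apply HM.
Qed.

Lemma is_C_RInt_derive (u du : R -> C) (a b : R) :
  (forall t, Rmin a b <= t <= Rmax a b -> is_curve_derive u t (du t)) ->
  (forall t, Rmin a b <= t <= Rmax a b -> C_continuous du t) ->
  is_C_RInt du a b (u b - u a)%C.
Proof.
  intros Hu Hdu. apply (is_RInt_derive (V := C_R_CompleteNormedModule) u du a b); [exact Hu|].
  intros t Ht. now apply C_continuous_prod, Hdu.
Qed.

Definition segment (a b : C) (t : R) : C := (a + RtoC t * (b - a))%C.

Definition segment_int (f : C -> C) (a b : C) : C :=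
  C_RInt (fun t => f (segment a b t) * (b - a))%C 0 1.

Definition convex (D : C -> Prop) : Prop :=
  forall a b t, D a -> D b -> 0 <= t <= 1 -> D (segment a b t).

Lemma segment_0 (a b : C) : segment a b 0 = a.
Proof. unfold segment. ring. Qed.

Lemma segment_1 (a b : C) : segment a b 1 = b.
Proof. unfold segment. ring. Qed.

Lemma is_curve_derive_segment (a b : C) (t : R) : is_curve_derive (segment a b) t (b - a)%C.
Proof.
  apply is_curve_derive_slope. exists (fun _ => b - a)%C. repeat split.
  - apply C_continuous_const.
  - intros s. unfold segment. ring.
Qed.

Lemma segment_continuous (a b : C) (t : R) : C_continuous (segment a b) t.
Proof. eapply is_curve_derive_continuous. apply is_curve_derive_segment. Qed.

Lemma convex_and (D E : C -> Prop) : convex D -> convex E -> convex (fun z => D z /\ E z).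
Proof.
  intros convex_D convex_E a b t [Da Ea] [Db Eb] Ht.
  split; [now apply convex_D|now apply convex_E].
Qed.

Lemma segment_int_refl (f : C -> C) (a : C) : segment_int f a a = RtoC 0.
Proof.
  transitivity (C_RInt (fun _ => RtoC 0) 0 1).
  - apply C_RInt_ext. intros t _. ring.
  - rewrite C_RInt_const. ring.
Qed.

Section SegmentIntegral.

Variables (D : C -> Prop) (f : C -> C).
Hypothesis convex_D : convex D.
Hypothesis continuous_f : C_continuous_on D f.

Lemma segment_integrand_continuous (a b : C) (t : R) : D a -> D b -> 0 <= t <= 1 ->
  C_continuous (fun t => f (segment a b t) * (b - a))%C t.
Proof.
  intros Da Db Ht. apply C_continuous_mult; [|apply C_continuous_const].
  apply C_continuous_comp; [apply segment_continuous|]. now apply continuous_f, convex_D.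
Qed.

Lemma is_segment_int (a b : C) : D a -> D b ->
  is_C_RInt (fun t => f (segment a b t) * (b - a))%C 0 1 (segment_int f a b).
Proof.
  intros Da Db. apply C_RInt_correct. rewrite Rmin_left, Rmax_right by lra.
  intros t Ht. now apply segment_integrand_continuous.
Qed.

Lemma segment_int_norm_le (a b : C) (M : R) : D a -> D b ->
  (forall t, 0 <= t <= 1 -> Cmod (f (segment a b t)) <= M) ->
  Cmod (segment_int f a b) <= M * Cmod (b - a)%C.
Proof.
  intros Da Db HM.
  replace (M * Cmod (b - a)%C) with ((1 - 0) * (M * Cmod (b - a)%C)) by ring.
  eapply is_C_RInt_norm_le; [lra| |now apply is_segment_int].
  intros t Ht. simpl. rewrite Cmod_mult. apply Rmult_le_compat_r; [apply Cmod_ge_0|now apply HM].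
Qed.

Lemma segment_int_primitive (F : C -> C) (a b : C) : D a -> D b ->
  (forall z, D z -> is_C_derive F z (f z)) -> segment_int f a b = (F b - F a)%C.
Proof.
  intros Da Db HF. apply is_C_RInt_unique.
  replace (F b - F a)%C with (F (segment a b 1) - F (segment a b 0))%C
    by now rewrite segment_0, segment_1.
  apply (is_C_RInt_derive (fun t => F (segment a b t))); rewrite Rmin_left, Rmax_right by lra;
    intros t Ht.
  - apply is_curve_derive_comp; [now apply HF, convex_D|apply is_curve_derive_segment].
  - now apply segment_integrand_continuous.
Qed.

Lemma segment_int_subsegment (a b : C) (u v : R) : D a -> D b -> 0 <= u <= 1 -> 0 <= v <= 1 ->
  segment_int f (segment a b u) (segment a b v) =
  C_RInt (fun t => f (segment a b t) * (b - a))%C u v.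
Proof.
  intros Da Db Hu Hv. apply is_C_RInt_unique.
  assert (HI : is_C_RInt (fun t => f (segment a b t) * (b - a))%C
      ((v - u) * 0 + u) ((v - u) * 1 + u)
      (C_RInt (fun t => f (segment a b t) * (b - a))%C u v)).
  { replace ((v - u) * 0 + u) with u by ring. replace ((v - u) * 1 + u) with v by ring.
    apply C_RInt_correct. intros t Ht. apply segment_integrand_continuous; auto.
    revert Ht. apply Rmin_case; apply Rmax_case; lra. }
  apply (is_RInt_comp_lin (V := C_R_NormedModule)) in HI.
  revert HI. apply is_C_RInt_ext. intros t _. rewrite scal_R_Cmult.
  replace (segment (segment a b u) (segment a b v) t) with (segment a b ((v - u) * t + u))
    by (unfold segment; rewrite RtoC_plus, RtoC_mult, RtoC_minus; ring).
  rewrite RtoC_minus. unfold segment at 3 4. ring.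
Qed.

Lemma segment_int_swap (a b : C) : D a -> D b -> segment_int f b a = (- segment_int f a b)%C.
Proof.
  intros Da Db.
  replace (segment_int f b a) with (segment_int f (segment a b 1) (segment a b 0))
    by now rewrite segment_0, segment_1.
  rewrite segment_int_subsegment by (auto; lra).
  symmetry. apply (opp_RInt_swap (V := C_R_CompleteNormedModule)).
  eexists. now apply is_segment_int.
Qed.

Lemma segment_int_split (a b : C) (t : R) : D a -> D b -> 0 <= t <= 1 ->
  segment_int f a b = (segment_int f a (segment a b t) + segment_int f (segment a b t) b)%C.
Proof.
  intros Da Db Ht.
  replace (segment_int f a (segment a b t)) with (segment_int f (segment a b 0) (segment a b t))
    by now rewrite segment_0.
  replace (segment_int f (segment a b t) b) with (segment_int f (segment a b t) (segment a b 1))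
    by now rewrite segment_1.
  rewrite !segment_int_subsegment by (auto; lra).
  assert (HI : ex_RInt (V := C_R_CompleteNormedModule)
    (fun t => f (segment a b t) * (b - a))%C 0 1) by (eexists; now apply is_segment_int).
  symmetry. apply (RInt_Chasles (V := C_R_CompleteNormedModule)).
  - now apply (ex_RInt_Chasles_1 (V := C_R_CompleteNormedModule) _ 0 t 1).
  - now apply (ex_RInt_Chasles_2 (V := C_R_CompleteNormedModule) _ 0 t 1).
Qed.

End SegmentIntegral.

Lemma segment_int_minus (D : C -> Prop) (f g : C -> C) (a b : C) :
  convex D -> C_continuous_on D f -> C_continuous_on D g -> D a -> D b ->
  segment_int (fun z => f z - g z)%C a b = (segment_int f a b - segment_int g a b)%C.
Proof.
  intros convex_D Hf Hg Da Db. apply is_C_RInt_unique.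
  apply is_C_RInt_ext with (fun t => f (segment a b t) * (b - a) - g (segment a b t) * (b - a))%C.
  - intros t _. ring.
  - apply is_C_RInt_minus; now apply (is_segment_int D).
Qed.

(** * Goursat's theorem *)

Definition triangle : Type := (C * C * C)%type.

Definition vertices_in (K : C -> Prop) (T : triangle) : Prop :=
  let '(a, b, c) := T in K a /\ K b /\ K c.

Definition base_vertex (T : triangle) : C := fst (fst T).

Definition perimeter (T : triangle) : R :=
  let '(a, b, c) := T in Cmod (b - a)%C + Cmod (c - b)%C + Cmod (a - c)%C.

Definition triangle_int (f : C -> C) (T : triangle) : C :=
  let '(a, b, c) := T in (segment_int f a b + segment_int f b c + segment_int f c a)%C.

Definition midpoint (a b : C) : C := segment a b (/ 2).

Definition halves_into (K : C -> Prop) (T T' : triangle) : Prop :=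
  vertices_in K T' /\ perimeter T' = perimeter T / 2 /\
  Cmod (base_vertex T' - base_vertex T)%C <= perimeter T.

Lemma perimeter_ge_0 (T : triangle) : 0 <= perimeter T.
Proof. destruct T as [[a b] c]. repeat apply Rplus_le_le_0_compat; apply Cmod_ge_0. Qed.

Lemma base_vertex_in (K : C -> Prop) (T : triangle) : vertices_in K T -> K (base_vertex T).
Proof. destruct T as [[a b] c]. now intros [Ka _]. Qed.

Lemma perimeter_scal (k : R) (a b c a' b' c' : C) :
  (b' - a')%C = (RtoC k * (b - a))%C -> (c' - b')%C = (RtoC k * (c - b))%C ->
  (a' - c')%C = (RtoC k * (a - c))%C -> perimeter (a', b', c') = Rabs k * perimeter (a, b, c).
Proof.
  intros Eab Ebc Eca. unfold perimeter. rewrite Eab, Ebc, Eca, !Cmod_mult, !Cmod_R. ring.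
Qed.

Lemma dist_base_vertex_le (a b c z : C) (u v : R) : 0 <= u <= 1 -> 0 <= v <= 1 ->
  z = (a + RtoC u * (b - a) - RtoC v * (a - c))%C -> Cmod (z - a)%C <= perimeter (a, b, c).
Proof.
  intros Hu Hv ->.
  replace (a + u * (b - a) - v * (a - c) - a)%C with (u * (b - a) + - (v * (a - c)))%C by ring.
  eapply Rle_trans; [apply Cmod_triangle|].
  rewrite Cmod_opp, !Cmod_mult, !Cmod_R, !Rabs_pos_eq by lra. unfold perimeter.
  generalize (Cmod_ge_0 (b - a)%C) (Cmod_ge_0 (c - b)%C) (Cmod_ge_0 (a - c)%C). nra.
Qed.

Lemma midpoint_alt (a b : C) : midpoint a b = ((a + b) / RtoC 2)%C.
Proof.
  unfold midpoint, segment. rewrite RtoC_inv by lra. field.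
Qed.

Lemma triangle_int_quadrisect (K : C -> Prop) (f : C -> C) (a b c : C) :
  convex K -> C_continuous_on K f -> K a -> K b -> K c ->
  let p := midpoint a b in let q := midpoint b c in let r := midpoint c a in
  triangle_int f (a, b, c) =
  (triangle_int f (a, p, r) + triangle_int f (p, b, q) +
   triangle_int f (r, q, c) + triangle_int f (q, r, p))%C.
Proof.
  intros convex_K Hf Ka Kb Kc p q r.
  assert (Kp : K p) by (apply convex_K; auto; lra).
  assert (Kq : K q) by (apply convex_K; auto; lra).
  assert (Kr : K r) by (apply convex_K; auto; lra).
  unfold triangle_int.
  rewrite (segment_int_split K f convex_K Hf a b (/ 2)),
    (segment_int_split K f convex_K Hf b c (/ 2)), (segment_int_split K f convex_K Hf c a (/ 2))
    by (auto; lra).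
  fold (midpoint a b) (midpoint b c) (midpoint c a). fold p q r.
  rewrite (segment_int_swap K f convex_K Hf p r), (segment_int_swap K f convex_K Hf q p),
    (segment_int_swap K f convex_K Hf r q) by auto.
  ring.
Qed.

Lemma medial_halves (K : C -> Prop) (a b c : C) : convex K -> K a -> K b -> K c ->
  let p := midpoint a b in let q := midpoint b c in let r := midpoint c a in
  halves_into K (a, b, c) (a, p, r) /\ halves_into K (a, b, c) (p, b, q) /\
  halves_into K (a, b, c) (r, q, c) /\ halves_into K (a, b, c) (q, r, p).
Proof.
  intros convex_K Ka Kb Kc p q r.
  assert (Kp : K p) by (apply convex_K; auto; lra).
  assert (Kq : K q) by (apply convex_K; auto; lra).
  assert (Kr : K r) by (apply convex_K; auto; lra).
  assert (Ehalf : RtoC (/ 2) = (/ RtoC 2)%C) by (apply RtoC_inv; lra).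
  assert (Hpos : perimeter (a, b, c) / 2 = Rabs (/ 2) * perimeter (a, b, c))
    by (rewrite Rabs_pos_eq; lra).
  assert (Hneg : perimeter (a, b, c) / 2 = Rabs (- / 2) * perimeter (a, b, c))
    by (rewrite Rabs_Ropp; lra).
  unfold halves_into, base_vertex, p, q, r in *. rewrite !midpoint_alt in *. simpl fst.
  repeat split; auto.
  1, 3, 5 : rewrite Hpos; apply perimeter_scal; rewrite Ehalf; field.
  - apply dist_base_vertex_le with 0 0; try lra. ring.
  - apply dist_base_vertex_le with (/ 2) 0; try lra. rewrite Ehalf. field.
  - apply dist_base_vertex_le with 0 (/ 2); try lra. rewrite Ehalf. field.
  - rewrite Hneg. apply perimeter_scal; rewrite RtoC_opp, Ehalf; field.
  - apply dist_base_vertex_le with (/ 2) (/ 2); try lra. rewrite Ehalf. field.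
Qed.

Lemma exists_quarter_triangle (K : C -> Prop) (f : C -> C) (T : triangle) :
  convex K -> C_continuous_on K f -> vertices_in K T ->
  exists T', halves_into K T T' /\ Cmod (triangle_int f T) <= 4 * Cmod (triangle_int f T').
Proof.
  destruct T as [[a b] c]. intros convex_K Hf [Ka [Kb Kc]].
  assert (E := triangle_int_quadrisect K f a b c convex_K Hf Ka Kb Kc).
  destruct (medial_halves K a b c convex_K Ka Kb Kc) as [Ha [Hb [Hc Hm]]].
  cbv zeta in E, Ha, Hb, Hc, Hm.
  set (Ta := (a, midpoint a b, midpoint c a)) in *.
  set (Tb := (midpoint a b, b, midpoint b c)) in *.
  set (Tc := (midpoint c a, midpoint b c, c)) in *.
  set (Tm := (midpoint b c, midpoint c a, midpoint a b)) in *.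
  set (total := Cmod (triangle_int f (a, b, c))) in *.
  assert (Hsum : total <= Cmod (triangle_int f Ta) + Cmod (triangle_int f Tb)
    + Cmod (triangle_int f Tc) + Cmod (triangle_int f Tm)).
  { unfold total. rewrite E.
    eapply Rle_trans; [apply Cmod_triangle|]. apply Rplus_le_compat_r.
    eapply Rle_trans; [apply Cmod_triangle|]. apply Rplus_le_compat_r.
    apply Cmod_triangle. }
  destruct (Rle_dec total (4 * Cmod (triangle_int f Ta))); [now exists Ta|].
  destruct (Rle_dec total (4 * Cmod (triangle_int f Tb))); [now exists Tb|].
  destruct (Rle_dec total (4 * Cmod (triangle_int f Tc))); [now exists Tc|].
  exists Tm. split; [exact Hm|lra].
Qed.

Lemma exists_nested_triangles (K : C -> Prop) (f : C -> C) (T : triangle) :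
  convex K -> C_continuous_on K f -> vertices_in K T ->
  exists S : nat -> triangle, forall n,
    vertices_in K (S n) /\ perimeter (S n) = perimeter T / 2 ^ n /\
    Cmod (base_vertex (S (n + 1)%nat) - base_vertex (S n))%C <= perimeter T / 2 ^ n /\
    Cmod (triangle_int f T) <= 4 ^ n * Cmod (triangle_int f (S n)).
Proof.
  intros convex_K Hf HT.
  set (quarter_of P P' := halves_into K P P' /\
    Cmod (triangle_int f P) <= 4 * Cmod (triangle_int f P')).
  assert (Next : forall P : {T | vertices_in K T}, {P' : {T | vertices_in K T} |
    quarter_of (proj1_sig P) (proj1_sig P')}).
  { intros [P HP]. apply constructive_indefinite_description.
    destruct (exists_quarter_triangle K f P convex_K Hf HP) as [P' [HP' HI]].
    now exists (exist _ P' (proj1 HP')). }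
  set (S n := Nat.iter n (fun P => proj1_sig (Next P)) (exist _ T HT)).
  assert (HS : forall n, quarter_of (proj1_sig (S n)) (proj1_sig (S (n + 1)%nat))).
  { intros n. rewrite Nat.add_1_r. exact (proj2_sig (Next (S n))). }
  assert (Hperim : forall n, perimeter (proj1_sig (S n)) = perimeter T / 2 ^ n).
  { induction n as [|n IH]; [simpl; lra|].
    destruct (HS n) as [[_ [Hp _]] _]. rewrite Nat.add_1_r, IH in Hp. rewrite Hp.
    simpl. field. apply pow_nonzero. lra. }
  exists (fun n => proj1_sig (S n)). intros n. repeat split.
  - exact (proj2_sig (S n)).
  - apply Hperim.
  - rewrite <- Hperim. apply HS.
  - induction n as [|n IH]; [simpl; lra|].
    destruct (HS n) as [_ HI]. rewrite Nat.add_1_r in HI.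
    assert (Hpow : 0 < 4 ^ n) by (apply pow_lt; lra).
    simpl pow. eapply Rle_trans; [exact IH|].
    apply (Rmult_le_compat_l (4 ^ n)) in HI; lra.
Qed.

Lemma pow_half_lt (K eps : R) : 0 < eps -> exists n, K / 2 ^ n < eps.
Proof.
  intros He. destruct (cv_pow_half K eps He) as [n Hn]. exists n.
  specialize (Hn n (Nat.le_refl n)). unfold Rdist in Hn. rewrite Rminus_0_r in Hn.
  exact (Rle_lt_trans _ _ _ (Rle_abs _) Hn).
Qed.

Lemma geometric_cauchy_limit (u : nat -> C) (K : R) :
  (forall n, Cmod (u (n + 1)%nat - u n)%C <= K / 2 ^ n) ->
  exists l, forall n, Cmod (u n - l)%C <= 2 * K / 2 ^ n.
Proof.
  intros Hu.
  assert (Hpow : forall n, 0 < 2 ^ n) by (intros n; apply pow_lt; lra).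
  assert (Htail : forall n k, Cmod (u (n + k)%nat - u n)%C <= 2 * K / 2 ^ n - 2 * K / 2 ^ (n + k)).
  { intros n k. induction k as [|k IH].
    - rewrite Nat.add_0_r. replace (u n - u n)%C with (RtoC 0) by ring. rewrite Cmod_0. lra.
    - rewrite Nat.add_succ_r, <- Nat.add_1_r.
      eapply Rle_trans; [apply (Cmod_minus_triangle _ (u (n + k)%nat))|].
      replace (2 * K / 2 ^ (n + k + 1)) with (2 * K / 2 ^ (n + k) - K / 2 ^ (n + k))
        by (rewrite (pow_add _ (n + k)); field; generalize (Hpow (n + k)%nat); lra).
      generalize (Hu (n + k)%nat). lra. }
  assert (K_ge_0 : 0 <= 2 * K).
  { generalize (Cmod_ge_0 (u (0 + 1)%nat - u 0%nat)%C) (Hu 0%nat). simpl. lra. }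
  assert (Hdist : forall n m, (n <= m)%nat -> Cmod (u m - u n)%C <= 2 * K / 2 ^ n).
  { intros n m Hnm. replace m with (n + (m - n))%nat by lia.
    generalize (Htail n (m - n)%nat) (Rdiv_le_0_compat _ _ K_ge_0 (Hpow (n + (m - n))%nat)). lra. }
  destruct (proj1 (filterlim_locally_cauchy (U := C_R_CompleteNormedModule) (F := eventually) u))
    as [l Hl].
  - intros eps. destruct (pow_half_lt (4 * K) eps (cond_pos eps)) as [N HN].
    exists (fun n => (N <= n)%nat). split; [now exists N|].
    intros n m Hn Hm. apply (norm_compat1 (V := C_R_NormedModule)). rewrite <- Cmod_norm.
    eapply Rle_lt_trans; [apply (Cmod_minus_triangle _ (u N))|]. rewrite (Cmod_minus_sym (u N)).
    replace (4 * K / 2 ^ N) with (2 * K / 2 ^ N + 2 * K / 2 ^ N) in HN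
      by (field; generalize (Hpow N); lra).
    generalize (Hdist N n Hn) (Hdist N m Hm). lra.
  - exists l. intros n. apply le_epsilon. intros eps He.
    destruct (proj1 (filterlim_locally_ball_norm (U := C_R_NormedModule) u l) Hl (mkposreal eps He))
      as [N HN].
    specialize (HN (Nat.max n N) (Nat.le_max_r _ _)). unfold ball_norm in HN.
    rewrite <- Cmod_norm in HN.
    eapply Rle_trans; [apply (Cmod_minus_triangle _ (u (Nat.max n N)))|].
    rewrite (Cmod_minus_sym (u n)). apply Rplus_le_compat; [now apply Hdist, Nat.le_max_l|].
    now left.
Qed.

Lemma triangle_int_near_affine (K : C -> Prop) (f : C -> C) (A l : C) (M : R) (T : triangle) :
  convex K -> C_continuous_on K f -> vertices_in K T ->
  (forall x, K x -> Cmod (f x - (A + x * l))%C <= M) ->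
  Cmod (triangle_int f T) <= M * perimeter T.
Proof.
  destruct T as [[a b] c]. intros convex_K Hf [Ka [Kb Kc]] HM.
  set (primitive x := (A * x + x * x / RtoC 2 * l)%C).
  assert (Hprim : forall x, is_C_derive primitive x (A + x * l)%C).
  { intros x. unfold primitive, Cdiv. eapply is_C_derive_eq.
    - apply is_C_derive_plus; [apply is_C_derive_scal, is_C_derive_id|].
      apply is_C_derive_mult; [|apply is_C_derive_const].
      apply is_C_derive_mult; [|apply is_C_derive_const].
      apply is_C_derive_mult; apply is_C_derive_id.
    - cbv beta. field. }
  assert (Haff : C_continuous_on K (fun x => A + x * l)%C).
  { intros x _. eapply is_C_derive_continuous. apply is_C_derive_plus; [apply is_C_derive_const|].
    apply is_C_derive_mult; [apply is_C_derive_id|apply is_C_derive_const]. }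
  assert (Hside : forall x y, K x -> K y ->
    Cmod (segment_int f x y - (primitive y - primitive x))%C <= M * Cmod (y - x)%C).
  { intros x y Kx Ky.
    rewrite <- (segment_int_primitive K (fun x => A + x * l)%C convex_K Haff primitive x y) by auto.
    rewrite <- (segment_int_minus K) by auto.
    apply (segment_int_norm_le K); auto.
    intros w Kw. apply (C_continuous_minus (T := CU)); auto. }
  unfold triangle_int, perimeter.
  replace (segment_int f a b + segment_int f b c + segment_int f c a)%C with
    ((segment_int f a b - (primitive b - primitive a)) +
     (segment_int f b c - (primitive c - primitive b)) +
     (segment_int f c a - (primitive a - primitive c)))%C by ring.
  eapply Rle_trans; [apply Cmod_triangle|].
  eapply Rle_trans; [apply Rplus_le_compat_r, Cmod_triangle|].
  generalize (Hside a b Ka Kb) (Hside b c Kb Kc) (Hside c a Kc Ka). lra.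
Qed.

Definition closed_disc (c : C) (r : R) (z : C) : Prop := Cmod (z - c)%C <= r.

Lemma convex_closed_disc (c : C) (r : R) : convex (closed_disc c r).
Proof.
  intros a b t Ha Hb Ht. unfold closed_disc, segment in *.
  replace (a + t * (b - a) - c)%C with (RtoC (1 - t) * (a - c) + RtoC t * (b - c))%C
    by (rewrite RtoC_minus; ring).
  eapply Rle_trans; [apply Cmod_triangle|].
  rewrite !Cmod_mult, !Cmod_R, !Rabs_pos_eq by lra. nra.
Qed.

Lemma vertices_in_closed_disc (T : triangle) (z : C) (d : R) :
  Cmod (base_vertex T - z)%C <= d -> vertices_in (closed_disc z (d + perimeter T)) T.
Proof.
  destruct T as [[a b] c]. unfold base_vertex, vertices_in, closed_disc, perimeter. simpl.
  intros Hd.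
  assert (Hab := Cmod_ge_0 (b - a)%C). assert (Hbc := Cmod_ge_0 (c - b)%C).
  assert (Hca := Cmod_ge_0 (a - c)%C). repeat split.
  - lra.
  - generalize (Cmod_minus_triangle b a z). lra.
  - generalize (Cmod_minus_triangle c a z). rewrite (Cmod_minus_sym c a). lra.
Qed.

Lemma triangle_int_little_o (K : C -> Prop) (f : C -> C) (z l : C) (eps : R) :
  convex K -> C_continuous_on K f -> is_C_derive f z l -> 0 < eps ->
  exists d : posreal, forall (T : triangle) (r : R), r < d ->
    vertices_in K T -> vertices_in (closed_disc z r) T -> perimeter T <= r ->
    Cmod (triangle_int f T) <= eps * r ^ 2.
Proof.
  intros convex_K Hf Hl He. rewrite is_C_derive_iff in Hl.
  destruct (Hl (mkposreal eps He)) as [d Hd]. simpl in Hd.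
  exists d. intros T r Hr KT HT HP.
  assert (Hr0 : 0 <= r) by (generalize (perimeter_ge_0 T); lra).
  apply Rle_trans with (eps * r * perimeter T).
  - apply (triangle_int_near_affine (fun x => K x /\ closed_disc z r x) f (f z - z * l)%C l).
    + apply convex_and; [exact convex_K|apply convex_closed_disc].
    + intros x [Kx _]. now apply Hf.
    + destruct T as [[u v] w]. simpl in *. tauto.
    + intros x [Kx Hx]. unfold closed_disc in Hx.
      replace (f x - (f z - z * l + x * l))%C with (f x - f z - (x - z) * l)%C by ring.
      eapply Rle_trans; [apply Hd; exact (Rle_lt_trans _ _ _ Hx Hr)|].
      apply Rmult_le_compat_l; [now left|exact Hx].
  - replace (eps * r ^ 2) with (eps * r * r) by ring.
    apply Rmult_le_compat_l; [|exact HP]. apply Rmult_le_pos; lra.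
Qed.

Theorem goursat (K : C -> Prop) (f : C -> C) (T : triangle) :
  closed (T := CU) K -> convex K -> holomorphic_on K f -> vertices_in K T ->
  triangle_int f T = RtoC 0.
Proof.
  intros closed_K convex_K Hol HT. assert (Hf := holomorphic_on_continuous K f Hol).
  destruct (exists_nested_triangles K f T convex_K Hf HT) as [S HS].
  set (p := perimeter T) in *. assert (Hp : 0 <= p) by apply perimeter_ge_0.
  destruct (geometric_cauchy_limit (fun n => base_vertex (S n)) p) as [z Hz]; [apply HS|].
  assert (Kz : K z).
  { apply closed_K. intros [d Hd]. destruct (pow_half_lt (2 * p) d (cond_pos d)) as [n Hn].
    apply (Hd (base_vertex (S n))); [|apply base_vertex_in, HS].
    exact (Rle_lt_trans _ _ _ (Hz n) Hn). }
  destruct (Hol z Kz) as [l Hl].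
  apply Cmod_eq_0, Rle_antisym; [|apply Cmod_ge_0]. apply le_epsilon. intros eps He.
  rewrite Rplus_0_l.
  assert (Hden : 0 < 9 * p ^ 2 + 1) by nra.
  destruct (triangle_int_little_o K f z l (eps / (9 * p ^ 2 + 1)) convex_K Hf Hl) as [d Hd].
  { now apply Rdiv_lt_0_compat. }
  destruct (pow_half_lt (3 * p) d (cond_pos d)) as [n Hn].
  destruct (HS n) as [HSn [Hperim [_ HI]]]. specialize (Hz n).
  assert (pow2_pos : 0 < 2 ^ n) by (apply pow_lt; lra).
  assert (pow4_pos : 0 < 4 ^ n) by (apply pow_lt; lra).
  assert (Hq : 0 <= p / 2 ^ n) by now apply Rdiv_le_0_compat.
  assert (E3p : 3 * p / 2 ^ n = 2 * p / 2 ^ n + perimeter (S n)) by (rewrite Hperim; field; lra).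
  assert (Hsmall := Hd (S n) (3 * p / 2 ^ n) Hn HSn).
  rewrite E3p in Hsmall at 1 2. rewrite Hperim in Hsmall at 2.
  specialize (Hsmall (vertices_in_closed_disc (S n) z _ Hz)).
  eapply Rle_trans; [exact HI|].
  eapply Rle_trans; [apply Rmult_le_compat_l; [now left|apply Hsmall; lra]|].
  replace (4 ^ n * (eps / (9 * p ^ 2 + 1) * (3 * p / 2 ^ n) ^ 2))
    with (eps * (9 * p ^ 2 / (9 * p ^ 2 + 1))).
  - rewrite <- (Rmult_1_r eps) at 2. apply Rmult_le_compat_l; [lra|].
    apply Rle_div_l; lra.
  - replace (4 ^ n) with (2 ^ n * 2 ^ n) by (rewrite <- Rpow_mult_distr; f_equal; ring).
    field. lra.
Qed.

(** * Primitives on discs *)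

Definition open_disc (c : C) (r : R) (z : C) : Prop := Cmod (z - c)%C < r.

Lemma convex_open_disc (c : C) (r : R) : convex (open_disc c r).
Proof.
  intros a b t Ha Hb Ht. unfold open_disc in *.
  eapply Rle_lt_trans.
  - apply (convex_closed_disc c (Rmax (Cmod (a - c)) (Cmod (b - c))) a b t); [| |exact Ht].
    + apply Rmax_l.
    + apply Rmax_r.
  - now apply Rmax_lub_lt.
Qed.

Lemma open_disc_center (c : C) (r : R) : 0 < r -> open_disc c r c.
Proof. unfold open_disc. replace (c - c)%C with (RtoC 0) by ring. now rewrite Cmod_0. Qed.

Lemma open_disc_radius_pos (c z : C) (r : R) : open_disc c r z -> 0 < r.
Proof. apply Rle_lt_trans, Cmod_ge_0. Qed.

Lemma locally_open_disc (c z : C) (r : R) : open_disc c r z -> locally (T := CU) z (open_disc c r).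
Proof.
  intros Hz. assert (Hd : 0 < r - Cmod (z - c)%C) by (unfold open_disc in Hz; lra).
  exists (mkposreal _ Hd). intros w Hw. unfold open_disc.
  change (Cmod (w - z)%C < r - Cmod (z - c)%C) in Hw.
  generalize (Cmod_minus_triangle w z c). lra.
Qed.

Lemma closed_closed_disc (c : C) (r : R) : closed (T := CU) (closed_disc c r).
Proof.
  apply (closed_comp (T := CU) (fun z => Cmod (z - c)%C) (fun u => u <= r)); [|apply closed_le].
  intros z. apply (continuous_comp (U := CU) (V := CU) (fun w => w - c)%C Cmod).
  - eapply is_C_derive_continuous. apply is_C_derive_minus_const.
  - exact (continuous_abs (K := C_AbsRing) (z - c)%C).
Qed.

Definition closed_half_plane (p d : C) (m : R) (z : C) : Prop := m <= Re ((z - p) * Cconj d)%C.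

Lemma Re_half_plane_continuous (p d z : C) :
  @continuous CU R_UniformSpace (fun w => Re ((w - p) * Cconj d)%C) z.
Proof.
  apply (C_continuous_Re (T := CU)). apply C_continuous_mult; [|apply C_continuous_const].
  eapply is_C_derive_continuous. apply is_C_derive_minus_const.
Qed.

Lemma closed_closed_half_plane (p d : C) (m : R) : closed (T := CU) (closed_half_plane p d m).
Proof.
  apply (closed_comp (T := CU) (fun z => Re ((z - p) * Cconj d)%C) (fun u => m <= u)).
  - intros z. apply Re_half_plane_continuous.
  - apply closed_ge.
Qed.

Lemma Re_half_plane_segment (p d a b : C) (t : R) :
  Re ((segment a b t - p) * Cconj d)%C =
  (1 - t) * Re ((a - p) * Cconj d)%C + t * Re ((b - p) * Cconj d)%C.
Proof.
  rewrite <- !re_scal_l, <- re_plus. f_equal. unfold segment. rewrite RtoC_minus. ring.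
Qed.

Lemma convex_closed_half_plane (p d : C) (m : R) : convex (closed_half_plane p d m).
Proof.
  intros a b t Ha Hb Ht. unfold closed_half_plane in *. rewrite Re_half_plane_segment. nra.
Qed.

Lemma segment_int_near_const (D : C -> Prop) (f : C -> C) (a b A : C) (M : R) :
  convex D -> C_continuous_on D f -> D a -> D b ->
  (forall t, 0 <= t <= 1 -> Cmod (f (segment a b t) - A)%C <= M) ->
  Cmod (segment_int f a b - (b - a) * A)%C <= M * Cmod (b - a)%C.
Proof.
  intros convex_D Hf Da Db HM.
  assert (HA : C_continuous_on D (fun _ => A)).
  { intros z _. apply (C_continuous_const (T := CU)). }
  replace ((b - a) * A)%C with (segment_int (fun _ => A) a b)
    by (unfold segment_int; rewrite C_RInt_const, RtoC_minus; ring).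
  rewrite <- (segment_int_minus D) by auto.
  apply (segment_int_norm_le D); auto.
  intros z Dz. apply (C_continuous_minus (T := CU)); auto.
Qed.

Lemma is_C_derive_segment_int (D : C -> Prop) (f : C -> C) (p z : C) :
  convex D -> C_continuous_on D f -> D p -> D z ->
  locally (T := CU) z (fun w => D w /\ triangle_int f (p, z, w) = RtoC 0) ->
  is_C_derive (segment_int f p) z (f z).
Proof.
  intros convex_D Hf Dp Dz [d_loc Hloc]. apply is_C_derive_iff. intros eps.
  destruct (proj1 (C_continuous_iff (T := CU) f z) (Hf z Dz) eps) as [d_cont Hnear].
  assert (Hd : 0 < Rmin d_loc d_cont) by (apply Rmin_pos; apply cond_pos).
  exists (mkposreal _ Hd). intros w Hw. change (open_disc z (Rmin d_loc d_cont) w) in Hw.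
  destruct (Hloc w (Rlt_le_trans _ _ _ Hw (Rmin_l _ _))) as [Dw HT].
  replace (segment_int f p w - segment_int f p z)%C with (segment_int f z w).
  - apply (segment_int_near_const D); auto. intros t Ht. left. apply Hnear.
    apply Rlt_le_trans with (2 := Rmin_r d_loc d_cont).
    now apply (convex_open_disc z); [apply open_disc_center| |].
  - unfold triangle_int in HT. rewrite (segment_int_swap D f convex_D Hf p w) in HT by auto.
    apply Ceq_minus. rewrite <- HT. ring.
Qed.

Lemma Re_mult_Cconj_pos (z : C) : z <> RtoC 0 -> 0 < Re (z * Cconj z)%C.
Proof.
  intros Hz. rewrite <- Cmod2_conj. apply pow_lt. now apply Cmod_gt_0.
Qed.

Lemma perimeter_shrink (p z w : C) (t : R) : 0 <= t ->
  perimeter (p, segment p z t, segment p w t) = t * perimeter (p, z, w).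
Proof.
  intros Ht. rewrite <- (Rabs_pos_eq t Ht) at 3.
  apply perimeter_scal; unfold segment; ring.
Qed.

Lemma triangle_int_cut (D : C -> Prop) (f : C -> C) (p z w : C) (t : R) :
  convex D -> C_continuous_on D f -> D p -> D z -> D w -> 0 <= t <= 1 ->
  let z' := segment p z t in let w' := segment p w t in
  triangle_int f (p, z, w) =
  (triangle_int f (p, z', w') + triangle_int f (z', z, w) + triangle_int f (z', w, w'))%C.
Proof.
  intros convex_D Hf Dp Dz Dw Ht z' w'.
  assert (Dz' : D z') by now apply convex_D.
  assert (Dw' : D w') by now apply convex_D.
  unfold triangle_int.
  rewrite (segment_int_swap D f convex_D Hf p w), (segment_int_swap D f convex_D Hf p w'),
    (segment_int_swap D f convex_D Hf z' w), (segment_int_swap D f convex_D Hf z' w'),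
    (segment_int_swap D f convex_D Hf w' w) by auto.
  rewrite (segment_int_split D f convex_D Hf p z t), (segment_int_split D f convex_D Hf p w t)
    by auto.
  fold z' w'. ring.
Qed.

(* [K] is the intersection of a closed disc and a closed half-plane; the condition on [w] lets the
   half-plane contain [w] along with [z], but not [p]. *)
Lemma exists_closed_convex_avoiding (c p z w : C) (r t : R) :
  open_disc c r p -> open_disc c r z -> open_disc c r w -> z <> p ->
  0 < Re ((w - p) * Cconj (z - p))%C -> 0 < t <= 1 ->
  exists K, closed (T := CU) K /\ convex K /\ (forall x, K x -> open_disc c r x /\ x <> p) /\
    K z /\ K w /\ K (segment p z t) /\ K (segment p w t).
Proof.
  intros Dp Dz Dw Nz Hw Ht.
  set (h x := Re ((x - p) * Cconj (z - p))%C).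
  assert (Hz : 0 < h z) by now apply Re_mult_Cconj_pos, Cminus_eq_contra.
  assert (hp : h p = 0).
  { unfold h. replace (p - p)%C with (RtoC 0) by ring. now rewrite re_scal_l, Rmult_0_l. }
  set (m := Rmin (h z) (h w)). assert (Hm : 0 < m) by now apply Rmin_pos.
  set (rho := Rmax (Cmod (p - c)%C) (Rmax (Cmod (z - c)%C) (Cmod (w - c)%C))).
  assert (Pp : closed_disc c rho p) by apply Rmax_l.
  assert (Pz : closed_disc c rho z) by (eapply Rle_trans; [|apply Rmax_r]; apply Rmax_l).
  assert (Pw : closed_disc c rho w) by (eapply Rle_trans; [|apply Rmax_r]; apply Rmax_r).
  exists (fun x => closed_disc c rho x /\ closed_half_plane p (z - p) (t * m) x).
  assert (Hin : forall x, closed_disc c rho x -> m <= h x ->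
    (closed_disc c rho x /\ closed_half_plane p (z - p) (t * m) x) /\
    (closed_disc c rho (segment p x t) /\ closed_half_plane p (z - p) (t * m) (segment p x t))).
  { intros x Px Hx. repeat split; auto; unfold closed_half_plane.
    - fold (h x). nra.
    - apply convex_closed_disc; auto; lra.
    - rewrite Re_half_plane_segment. fold (h x) (h p). rewrite hp. nra. }
  destruct (Hin z Pz (Rmin_l _ _)) as [Kz Kz'], (Hin w Pw (Rmin_r _ _)) as [Kw Kw'].
  split; [|split; [|split; [|tauto]]].
  - apply (closed_and (T := CU)); [apply closed_closed_disc|apply closed_closed_half_plane].
  - apply convex_and; [apply convex_closed_disc|apply convex_closed_half_plane].
  - intros x [Px Hx]. split.
    + eapply Rle_lt_trans; [exact Px|]. now repeat apply Rmax_lub_lt.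
    + intros ->. unfold closed_half_plane in Hx. fold (h p) in Hx. nra.
Qed.

Section ExceptionalPoint.

Variables (c p : C) (r : R) (f : C -> C).
Hypothesis disc_p : open_disc c r p.
Hypothesis continuous_f : C_continuous_on (open_disc c r) f.
Hypothesis holomorphic_f : holomorphic_on (fun z => open_disc c r z /\ z <> p) f.

Lemma triangle_int_shrink (z w : C) (t : R) :
  open_disc c r z -> open_disc c r w -> z <> p ->
  0 < Re ((w - p) * Cconj (z - p))%C -> 0 < t <= 1 ->
  triangle_int f (p, z, w) = triangle_int f (p, segment p z t, segment p w t).
Proof.
  intros Dz Dw Nz Hw Ht.
  destruct (exists_closed_convex_avoiding c p z w r t)
    as [K [closed_K [convex_K [subset_K [Kz [Kw [Kz' Kw']]]]]]]; auto.
  assert (Hol := holomorphic_on_subset _ _ f subset_K holomorphic_f).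
  rewrite (triangle_int_cut (open_disc c r) f p z w t) by (auto using convex_open_disc; lra).
  rewrite (goursat K f (segment p z t, z, w)), (goursat K f (segment p z t, w, segment p w t))
    by (auto; repeat split; auto).
  ring.
Qed.

Lemma triangle_int_exceptional_vertex (z w : C) :
  open_disc c r z -> open_disc c r w -> z <> p -> 0 < Re ((w - p) * Cconj (z - p))%C ->
  triangle_int f (p, z, w) = RtoC 0.
Proof.
  intros Dz Dw Nz Hw.
  assert (HP := perimeter_ge_0 (p, z, w)). set (P := perimeter (p, z, w)) in *.
  apply Cmod_eq_0, Rle_antisym; [|apply Cmod_ge_0]. apply le_epsilon. intros eps He.
  rewrite Rplus_0_l.
  destruct (proj1 (C_continuous_iff (T := CU) f p) (continuous_f p disc_p) (mkposreal 1 Rlt_0_1))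
    as [d Hd]. simpl in Hd.
  set (m := Rmin 1 (Rmin d eps)).
  assert (Hm : 0 < m) by (repeat apply Rmin_pos; [lra|apply cond_pos|lra]).
  assert (Hm1 : m <= 1) by apply Rmin_l.
  assert (Hmd : m <= d) by (eapply Rle_trans; [apply Rmin_r|apply Rmin_l]).
  assert (Hme : m <= eps) by (eapply Rle_trans; [apply Rmin_r|apply Rmin_r]).
  set (t := m / (P + 1)).
  assert (Ht : 0 < t <= 1).
  { split; [apply Rdiv_lt_0_compat; lra|apply Rle_div_l; lra]. }
  assert (HtP : t * P < m).
  { assert (Em : t * (P + 1) = m) by (unfold t; field; lra). nra. }
  rewrite (triangle_int_shrink z w t) by auto.
  assert (HV : vertices_in (closed_disc p (t * P)) (p, segment p z t, segment p w t)).
  { replace (t * P) with (0 + perimeter (p, segment p z t, segment p w t))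
      by (rewrite perimeter_shrink by lra; unfold P; ring).
    apply vertices_in_closed_disc. unfold base_vertex. simpl.
    replace (p - p)%C with (RtoC 0) by ring. rewrite Cmod_0. lra. }
  apply Rle_trans with (1 * perimeter (p, segment p z t, segment p w t)).
  - apply (triangle_int_near_affine (fun x => open_disc c r x /\ closed_disc p (t * P) x) f
      (f p) (RtoC 0)).
    + apply convex_and; [apply convex_open_disc|apply convex_closed_disc].
    + intros x [Dx _]. now apply continuous_f.
    + assert (convex_D := convex_open_disc c r). simpl in *.
      repeat split; try tauto; apply convex_D; auto; lra.
    + intros x [_ Hx]. replace (f p + x * 0)%C with (f p) by ring. left. apply Hd.
      eapply Rle_lt_trans; [exact Hx|lra].
  - rewrite perimeter_shrink by lra. fold P. lra.
Qed.

Lemma disc_primitive (z : C) : open_disc c r z -> is_C_derive (segment_int f p) z (f z).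
Proof.
  intros Dz. apply (is_C_derive_segment_int (open_disc c r)); auto using convex_open_disc.
  destruct (Ceq_dec z p) as [-> | Nz].
  - generalize (locally_open_disc c p r Dz). apply filter_imp. intros w Dw. split; [exact Dw|].
    unfold triangle_int. rewrite segment_int_refl.
    rewrite (segment_int_swap (open_disc c r) f (convex_open_disc c r) continuous_f p w) by auto.
    ring.
  - assert (Hpos : locally (T := CU) z (fun w => 0 < Re ((w - p) * Cconj (z - p))%C)).
    { apply (Re_half_plane_continuous p (z - p) z (fun u => 0 < u)), open_gt.
      now apply Re_mult_Cconj_pos, Cminus_eq_contra. }
    generalize (filter_and _ _ (locally_open_disc c z r Dz) Hpos). apply filter_imp.
    intros w [Dw Hw]. split; [exact Dw|]. now apply triangle_int_exceptional_vertex.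
Qed.

End ExceptionalPoint.

(** * Cauchy's integral formula *)

Definition circle (c : C) (r t : R) : C := (c + RtoC r * cexpi t)%C.

Definition continuous_on_circle (f : C -> C) (c : C) (r : R) : Prop :=
  forall t, C_continuous (fun s => f (circle c r s)) t.

Definition circle_int (f : C -> C) (c : C) (r : R) : C :=
  C_RInt (fun t => f (circle c r t) * (Ci * (circle c r t - c)))%C 0 (2 * PI).

Lemma Cmod_cexpi (t : R) : Cmod (cexpi t) = 1.
Proof.
  unfold Cmod, cexpi. simpl. rewrite !Rmult_1_r, Rplus_comm.
  change (sqrt (Rsqr (sin t) + Rsqr (cos t)) = 1). rewrite sin2_cos2. apply sqrt_1.
Qed.

Lemma is_curve_derive_cexpi (t : R) : is_curve_derive cexpi t (Ci * cexpi t)%C.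
Proof.
  eapply is_curve_derive_eq.
  - apply (is_curve_derive_pair cos sin); [apply is_derive_cos|apply is_derive_sin].
  - unfold Ci, cexpi, Cmult. simpl. f_equal; ring.
Qed.

Lemma circle_2PI (c : C) (r : R) : circle c r (2 * PI) = circle c r 0.
Proof. unfold circle, cexpi. now rewrite cos_2PI, sin_2PI, cos_0, sin_0. Qed.

Lemma Cmod_circle_minus_center (c : C) (r t : R) : 0 <= r -> Cmod (circle c r t - c)%C = r.
Proof.
  intros Hr. unfold circle. replace (c + r * cexpi t - c)%C with (r * cexpi t)%C by ring.
  rewrite Cmod_mult, Cmod_R, Cmod_cexpi, Rabs_pos_eq; lra.
Qed.

Lemma circle_in_open_disc (c : C) (r r' t : R) : 0 <= r < r' -> open_disc c r' (circle c r t).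
Proof. intros Hr. unfold open_disc. rewrite Cmod_circle_minus_center; lra. Qed.

Lemma dist_circle_ge (c a : C) (r t : R) : 0 <= r ->
  r - Cmod (a - c)%C <= Cmod (circle c r t - a)%C.
Proof.
  intros Hr. generalize (Cmod_triangle_rev (circle c r t - c)%C (a - c)%C).
  rewrite Cmod_circle_minus_center by exact Hr.
  now replace (circle c r t - c - (a - c))%C with (circle c r t - a)%C by ring.
Qed.

Lemma circle_neq (c a : C) (r t : R) : open_disc c r a -> (circle c r t - a)%C <> RtoC 0.
Proof.
  unfold open_disc. intros Ha. apply Cmod_gt_0.
  generalize (Cmod_ge_0 (a - c)%C) (dist_circle_ge c a r t). lra.
Qed.

Lemma is_curve_derive_circle (c : C) (r t : R) :
  is_curve_derive (circle c r) t (Ci * (circle c r t - c))%C.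
Proof.
  unfold circle. eapply is_curve_derive_eq.
  - apply (is_curve_derive_comp (fun z => c + RtoC r * z)%C cexpi); [|apply is_curve_derive_cexpi].
    apply is_C_derive_plus; [apply is_C_derive_const|apply is_C_derive_scal, is_C_derive_id].
  - ring.
Qed.

Lemma circle_continuous (c : C) (r t : R) : C_continuous (circle c r) t.
Proof. eapply is_curve_derive_continuous. apply is_curve_derive_circle. Qed.

Lemma C_continuous_bounded (u : R -> C) (a b : R) : (forall t, C_continuous u t) ->
  exists M, 0 <= M /\ forall t, a <= t <= b -> Cmod (u t) <= M.
Proof.
  intros Hu. destruct (bounded_continuity (K := C_AbsRing) (V := CV) u a b) as [M HM].
  - intros t _. apply Hu.
  - exists (Rabs M). split; [apply Rabs_pos|]. intros t Ht.
    left. eapply Rlt_le_trans; [exact (HM t Ht)|apply Rle_abs].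
Qed.

Section CircleIntegral.

Variables (c : C) (r : R).

Lemma continuous_on_circle_inv_pow (f : C -> C) (m : nat) (a : C) : open_disc c r a ->
  continuous_on_circle f c r -> continuous_on_circle (fun z => f z * (/ (z - a)) ^ m)%C c r.
Proof.
  intros Ha Hf t. apply C_continuous_mult; [apply Hf|]. apply C_continuous_pow, C_continuous_inv.
  - apply C_continuous_minus; [apply circle_continuous|apply C_continuous_const].
  - now apply circle_neq.
Qed.

Lemma continuous_on_circle_minus (f g : C -> C) :
  continuous_on_circle f c r -> continuous_on_circle g c r ->
  continuous_on_circle (fun z => f z - g z)%C c r.
Proof. intros Hf Hg t. apply C_continuous_minus; [apply Hf|apply Hg]. Qed.

Lemma continuous_on_circle_scal (k : C) (f : C -> C) :
  continuous_on_circle f c r -> continuous_on_circle (fun z => k * f z)%C c r.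
Proof. intros Hf t. apply C_continuous_mult; [apply C_continuous_const|apply Hf]. Qed.

Lemma circle_integrand_continuous (f : C -> C) (t : R) : continuous_on_circle f c r ->
  C_continuous (fun t => f (circle c r t) * (Ci * (circle c r t - c)))%C t.
Proof.
  intros Hf. apply C_continuous_mult; [apply Hf|].
  apply C_continuous_mult; [apply C_continuous_const|].
  apply C_continuous_minus; [apply circle_continuous|apply C_continuous_const].
Qed.

Lemma is_circle_int (f : C -> C) : continuous_on_circle f c r ->
  is_C_RInt (fun t => f (circle c r t) * (Ci * (circle c r t - c)))%C 0 (2 * PI) (circle_int f c r).
Proof. intros Hf. apply C_RInt_correct. intros t _. now apply circle_integrand_continuous. Qed.

Lemma circle_int_ext (f g : C -> C) :
  (forall t, f (circle c r t) = g (circle c r t)) -> circle_int f c r = circle_int g c r.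
Proof. intros E. apply C_RInt_ext. intros t _. now rewrite E. Qed.

Lemma circle_int_scal (k : C) (f : C -> C) : continuous_on_circle f c r ->
  circle_int (fun z => k * f z)%C c r = (k * circle_int f c r)%C.
Proof.
  intros Hf. apply is_C_RInt_unique.
  apply is_C_RInt_ext with (fun t => k * (f (circle c r t) * (Ci * (circle c r t - c))))%C.
  - intros t _. ring.
  - now apply is_C_RInt_scal, is_circle_int.
Qed.

Lemma circle_int_minus (f g : C -> C) : continuous_on_circle f c r -> continuous_on_circle g c r ->
  circle_int (fun z => f z - g z)%C c r = (circle_int f c r - circle_int g c r)%C.
Proof.
  intros Hf Hg. apply is_C_RInt_unique.
  apply is_C_RInt_ext with (fun t => f (circle c r t) * (Ci * (circle c r t - c)) -
    g (circle c r t) * (Ci * (circle c r t - c)))%C.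
  - intros t _. ring.
  - apply is_C_RInt_minus; now apply is_circle_int.
Qed.

Lemma circle_int_norm_le (f : C -> C) (M : R) : 0 < r -> continuous_on_circle f c r ->
  (forall t, 0 <= t <= 2 * PI -> Cmod (f (circle c r t)) <= M) ->
  Cmod (circle_int f c r) <= 2 * PI * (M * r).
Proof.
  intros Hr Hf HM. replace (2 * PI * (M * r)) with ((2 * PI - 0) * (M * r)) by ring.
  apply is_C_RInt_norm_le with (3 := is_circle_int f Hf); [generalize PI_RGT_0; lra|].
  intros t Ht. simpl. rewrite !Cmod_mult, Cmod_Ci, Cmod_circle_minus_center, Rmult_1_l by lra.
  apply Rmult_le_compat_r; [lra|now apply HM].
Qed.

Lemma circle_int_derivative (F f : C -> C) : continuous_on_circle f c r ->
  (forall t, is_C_derive F (circle c r t) (f (circle c r t))) -> circle_int f c r = RtoC 0.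
Proof.
  intros Hf HF. apply is_C_RInt_unique.
  replace (RtoC 0) with (F (circle c r (2 * PI)%R) - F (circle c r 0%R))%C
    by (rewrite circle_2PI; ring).
  apply (is_C_RInt_derive (fun t => F (circle c r t))).
  - intros t _. apply is_curve_derive_comp; [apply HF|apply is_curve_derive_circle].
  - intros t _. now apply circle_integrand_continuous.
Qed.

End CircleIntegral.

Lemma is_C_derive_quadratic (f : C -> C) (z l : C) (d B : R) : 0 < d ->
  (forall w, Cmod (w - z)%C < d -> Cmod (f w - f z - (w - z) * l)%C <= B * Cmod (w - z)%C ^ 2) ->
  is_C_derive f z l.
Proof.
  intros Hd HB. apply is_C_derive_iff. intros eps. assert (He := cond_pos eps).
  assert (HB1 : 0 < Rabs B + 1) by (generalize (Rabs_pos B); lra).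
  assert (Hmin : 0 < Rmin d (eps / (Rabs B + 1))).
  { apply Rmin_pos; [|apply Rdiv_lt_0_compat]; lra. }
  exists (mkposreal _ Hmin). intros w Hw.
  change (Cmod (w - z)%C < Rmin d (eps / (Rabs B + 1))) in Hw.
  eapply Rle_trans; [apply HB; exact (Rlt_le_trans _ _ _ Hw (Rmin_l _ _))|].
  assert (Hsmall := Rlt_le_trans _ _ _ Hw (Rmin_r _ _)). apply Rlt_div_r in Hsmall; [|lra].
  simpl. rewrite <- Rmult_assoc, Rmult_1_r. apply Rmult_le_compat_r; [apply Cmod_ge_0|].
  generalize (Rle_abs B) (Cmod_ge_0 (w - z)%C). nra.
Qed.

(* The relation [X - Y = h * X * Y] holds between the resolvents [X = 1 / (z - b)] and
   [Y = 1 / (z - a)] with [h = b - a]. *)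
Lemma resolvent_pow_taylor (m : nat) (A : R) : 0 <= A ->
  exists B, 0 <= B /\ forall X Y h : C,
    Cmod X <= A -> Cmod Y <= A -> (X - Y)%C = (h * X * Y)%C ->
    Cmod (X ^ m - Y ^ m - h * (RtoC (INR m) * Y ^ S m))%C <= B * Cmod h ^ 2.
Proof.
  intros HA. induction m as [|m [B [HB IH]]].
  - exists 0. split; [lra|]. intros X Y h _ _ _. simpl.
    replace (1 - 1 - h * (0 * (Y * 1)))%C with (RtoC 0) by ring. rewrite Cmod_0. lra.
  - assert (HAm : 0 <= A ^ (m + 3)) by now apply pow_le.
    assert (Hm : 0 <= INR (S m)) by apply pos_INR.
    exists (INR (S m) * A ^ (m + 3) + A * B). split; [nra|].
    intros X Y h HX HY E. specialize (IH X Y h HX HY E).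
    set (T := (X ^ m - Y ^ m - h * (RtoC (INR m) * Y ^ S m))%C) in *.
    replace (X ^ S m - Y ^ S m - h * (RtoC (INR (S m)) * Y ^ S (S m)))%C
      with (RtoC (INR (S m)) * (h * h) * (X * Y ^ (m + 2)) + X * T)%C.
    + eapply Rle_trans; [apply Cmod_triangle|].
      rewrite Rmult_plus_distr_r. apply Rplus_le_compat.
      * rewrite !Cmod_mult, Cmod_R, Rabs_pos_eq, Cmod_pow by exact Hm.
        replace (INR (S m) * A ^ (m + 3) * Cmod h ^ 2)
          with (INR (S m) * (Cmod h * Cmod h) * (A * A ^ (m + 2)))
          by (replace (m + 3)%nat with (S (m + 2)) by lia; simpl; ring).
        apply Rmult_le_compat_l; [repeat apply Rmult_le_pos; auto using Cmod_ge_0|].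
        apply Rmult_le_compat; auto using Cmod_ge_0, pow_le. apply pow_incr.
        auto using Cmod_ge_0.
      * rewrite Cmod_mult, Rmult_assoc. apply Rmult_le_compat; auto using Cmod_ge_0.
    + unfold T. rewrite S_INR, RtoC_plus, Cpow_add_r. simpl.
      assert (EX : X = (Y + h * X * Y)%C) by (rewrite <- E; ring).
      set (n := RtoC (INR m)).
      transitivity (X * X ^ m - Y * Y ^ m - h * ((n + 1) * (Y * (Y * Y ^ m)))
        + Y ^ m * (1 + (n + 1) * h * Y) * (Y + h * X * Y - X))%C; [ring|].
      rewrite <- EX. ring.
Qed.

Definition cauchy_integral (f : C -> C) (c : C) (r : R) (m : nat) (a : C) : C :=
  circle_int (fun z => f z * (/ (z - a)) ^ m)%C c r.

Lemma Cmod_inv_circle_le (c a : C) (r d t : R) : 0 < d -> open_disc c (r - d) a ->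
  Cmod (/ (circle c r t - a))%C <= / d.
Proof.
  unfold open_disc. intros Hd Ha. generalize (Cmod_ge_0 (a - c)%C). intros Ha0.
  rewrite Cmod_inv by (apply circle_neq; unfold open_disc; lra).
  apply Rinv_le_contravar; [exact Hd|]. generalize (dist_circle_ge c a r t). lra.
Qed.

Lemma is_C_derive_cauchy_integral (f : C -> C) (c : C) (r : R) (m : nat) (a : C) :
  continuous_on_circle f c r -> open_disc c r a ->
  is_C_derive (cauchy_integral f c r m) a (RtoC (INR m) * cauchy_integral f c r (S m) a)%C.
Proof.
  intros Hf Ha. set (d := (r - Cmod (a - c)%C) / 2).
  assert (Hd : 0 < d) by (unfold d, open_disc in *; lra).
  assert (Hr := open_disc_radius_pos c a r Ha).
  destruct (resolvent_pow_taylor m (/ d)) as [B [HB Htaylor]].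
  { left. now apply Rinv_0_lt_compat. }
  destruct (C_continuous_bounded (fun t => f (circle c r t)) 0 (2 * PI) Hf) as [M [HM Hbound]].
  apply is_C_derive_quadratic with d (2 * PI * (M * B * r)); [exact Hd|]. intros b Hb.
  assert (Hb' : open_disc c (r - d) b).
  { unfold open_disc, d in *. generalize (Cmod_minus_triangle b a c). lra. }
  assert (Hbr : open_disc c r b) by (unfold open_disc in *; lra).
  set (h := (b - a)%C) in *.
  assert (Cb := continuous_on_circle_inv_pow c r f m b Hbr Hf).
  assert (Ca := continuous_on_circle_inv_pow c r f m a Ha Hf).
  assert (CSa := continuous_on_circle_inv_pow c r f (S m) a Ha Hf).
  unfold cauchy_integral. rewrite Cmult_assoc.
  rewrite <- circle_int_minus, <- circle_int_scal, <- circle_int_minus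
    by auto using continuous_on_circle_minus, continuous_on_circle_scal.
  replace (2 * PI * (M * B * r) * Cmod h ^ 2) with (2 * PI * (M * (B * Cmod h ^ 2) * r)) by ring.
  apply circle_int_norm_le;
    [exact Hr|auto using continuous_on_circle_minus, continuous_on_circle_scal|].
  intros t Ht. set (z := circle c r t).
  replace (f z * (/ (z - b)) ^ m - f z * (/ (z - a)) ^ m - h * INR m * (f z * (/ (z - a)) ^ S m))%C
    with (f z * ((/ (z - b)) ^ m - (/ (z - a)) ^ m - h * (INR m * (/ (z - a)) ^ S m)))%C by ring.
  rewrite Cmod_mult. apply Rmult_le_compat; [apply Cmod_ge_0|apply Cmod_ge_0|now apply Hbound|].
  apply Htaylor.
  - now apply Cmod_inv_circle_le.
  - apply Cmod_inv_circle_le; [exact Hd|]. unfold open_disc, d. unfold open_disc in Ha. lra.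
  - unfold h. field. split; now apply circle_neq.
Qed.

Lemma is_C_derive_0_constant (D : C -> Prop) (F : C -> C) (a b : C) :
  convex D -> (forall z, D z -> is_C_derive F z (RtoC 0)) -> D a -> D b -> F a = F b.
Proof.
  intros convex_D HF Da Db. symmetry. apply Ceq_minus.
  rewrite <- (segment_int_primitive D (fun _ => RtoC 0) convex_D) with (F := F) by
    (auto; intros z _; apply (C_continuous_const (T := CU))).
  unfold segment_int. rewrite C_RInt_const. ring.
Qed.

Lemma cauchy_integral_winding (c : C) (r : R) (a : C) : open_disc c r a ->
  cauchy_integral (fun _ => RtoC 1) c r 1 a = (RtoC (2 * PI) * Ci)%C.
Proof.
  intros Ha. assert (Hr := open_disc_radius_pos c a r Ha).
  assert (Hc := open_disc_center c r Hr).
  assert (continuous_one : continuous_on_circle (fun _ => RtoC 1) c r).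
  { intros t. apply C_continuous_const. }
  rewrite (is_C_derive_0_constant (open_disc c r) (cauchy_integral (fun _ => RtoC 1) c r 1) a c);
    auto using convex_open_disc.
  - rewrite <- (Rminus_0_r (2 * PI)), <- C_RInt_const. apply C_RInt_ext. intros t _.
    simpl. field. now apply circle_neq.
  - intros b Hb. eapply is_C_derive_eq; [now apply is_C_derive_cauchy_integral|].
    replace (cauchy_integral (fun _ => RtoC 1) c r 2 b) with (RtoC 0); [ring|]. symmetry.
    apply (circle_int_derivative c r (fun z => RtoC (-1) * / (z - b))%C).
    + now apply (continuous_on_circle_inv_pow c r (fun _ => RtoC 1)).
    + intros t. eapply is_C_derive_eq.
      * apply is_C_derive_scal, is_C_derive_inv; [apply is_C_derive_minus_const|].
        now apply circle_neq.
      * simpl. field. now apply circle_neq.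
Qed.

Lemma continuous_on_circle_disc (f : C -> C) (c : C) (r r' : R) : 0 <= r < r' ->
  C_continuous_on (open_disc c r') f -> continuous_on_circle f c r.
Proof.
  intros Hr Hf t. apply C_continuous_comp; [apply circle_continuous|].
  now apply Hf, circle_in_open_disc.
Qed.

Lemma exists_slope_function (f : C -> C) (c : C) (r : R) (a : C) :
  holomorphic_on (open_disc c r) f -> open_disc c r a ->
  exists phi, C_continuous_on (open_disc c r) phi /\
    holomorphic_on (fun z => open_disc c r z /\ z <> a) phi /\
    forall z, f z = (f a + (z - a) * phi z)%C.
Proof.
  intros Hol Ha. destruct (Hol a Ha) as [l Hl]. apply is_C_derive_slope in Hl.
  destruct Hl as [phi [Cphi [_ Ephi]]].
  assert (Hphi : holomorphic_on (fun z => open_disc c r z /\ z <> a) phi).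
  { intros z [Dz Nz]. destruct (Hol z Dz) as [d Hd]. eexists.
    apply (is_C_derive_ext_loc (fun w => (f w - f a) * / (w - a))%C).
    - generalize (locally_Cneq z a Nz). apply filter_imp. intros w Nw. rewrite (Ephi w).
      field. now apply Cminus_eq_contra.
    - apply is_C_derive_mult; [apply is_C_derive_minus; [exact Hd|apply is_C_derive_const]|].
      apply is_C_derive_inv; [apply is_C_derive_minus_const|now apply Cminus_eq_contra]. }
  exists phi. repeat split; [|exact Hphi|exact Ephi].
  intros z Dz. destruct (Ceq_dec z a) as [-> | Nz]; [exact Cphi|].
  now apply (holomorphic_on_continuous _ phi Hphi).
Qed.

(* The slope of [f] at [a] has a primitive on the disc, so its integral over the circle vanishes. *)
Theorem cauchy_formula (f : C -> C) (c : C) (r r' : R) (a : C) :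
  holomorphic_on (open_disc c r') f -> r < r' -> open_disc c r a ->
  cauchy_integral f c r 1 a = (RtoC (2 * PI) * Ci * f a)%C.
Proof.
  intros Hol Hr' Ha. assert (Hr := open_disc_radius_pos c a r Ha).
  assert (Ha' : open_disc c r' a) by (unfold open_disc in *; lra).
  assert (Cf := continuous_on_circle_disc f c r r' ltac:(lra) (holomorphic_on_continuous _ f Hol)).
  destruct (exists_slope_function f c r' a Hol Ha') as [phi [Cphi [Hphi Ephi]]].
  assert (Iphi : circle_int phi c r = RtoC 0).
  { apply (circle_int_derivative c r (segment_int phi a)).
    - apply (continuous_on_circle_disc phi c r r'); [lra|exact Cphi].
    - intros t. apply (disc_primitive c a r'); auto. apply circle_in_open_disc. lra. }
  rewrite <- (cauchy_integral_winding c r a Ha), Cmult_comm.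
  apply Ceq_minus. rewrite <- Iphi. unfold cauchy_integral.
  assert (continuous_one : continuous_on_circle (fun _ => RtoC 1) c r).
  { intros t. apply C_continuous_const. }
  assert (continuous_inv := continuous_on_circle_inv_pow c r _ 1 a Ha continuous_one).
  rewrite <- circle_int_scal, <- circle_int_minus
    by auto using continuous_on_circle_scal, continuous_on_circle_inv_pow.
  apply circle_int_ext. intros t. rewrite (Ephi (circle c r t)). simpl. field. now apply circle_neq.
Qed.

(** * Consequences of Cauchy's formula *)

Lemma Ctwo_pi_i_nz : (RtoC (2 * PI) * Ci)%C <> RtoC 0.
Proof.
  apply Cmult_neq_0; [|exact Ci_nz]. intros E. apply RtoC_inj in E. generalize PI_RGT_0. lra.
Qed.

Lemma holomorphic_on_Cderiv_disc (f : C -> C) (c : C) (r : R) :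
  holomorphic_on (open_disc c r) f -> holomorphic_on (open_disc c r) (Cderiv f).
Proof.
  intros Hol z Hz. unfold open_disc in Hz.
  set (s := (Cmod (z - c)%C + r) / 2). set (k := (/ (RtoC (2 * PI) * Ci))%C).
  assert (Hs : Cmod (z - c)%C < s < r) by (unfold s; lra).
  assert (Hz0 := Cmod_ge_0 (z - c)%C).
  assert (Cf := continuous_on_circle_disc f c s r ltac:(lra) (holomorphic_on_continuous _ f Hol)).
  assert (Hderiv : forall a, open_disc c s a ->
    (k * (RtoC (INR 1) * cauchy_integral f c s 2 a))%C = Cderiv f a).
  { intros a Ha. symmetry. apply is_C_derive_Cderiv.
    apply (is_C_derive_ext_loc (fun w => k * cauchy_integral f c s 1 w)%C).
    - generalize (locally_open_disc c a s Ha). apply filter_imp. intros w Hw.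
      rewrite (cauchy_formula f c s r w Hol) by (tauto || lra).
      unfold k. rewrite Cmult_assoc, Cinv_l, Cmult_1_l; [reflexivity|exact Ctwo_pi_i_nz].
    - now apply is_C_derive_scal, is_C_derive_cauchy_integral. }
  eexists.
  apply (is_C_derive_ext_loc (fun a => k * (RtoC (INR 1) * cauchy_integral f c s 2 a))%C).
  - generalize (locally_open_disc c z s (proj1 Hs)). apply filter_imp. exact Hderiv.
  - apply is_C_derive_scal, is_C_derive_scal, is_C_derive_cauchy_integral; tauto.
Qed.

Lemma holomorphic_on_removable (f : C -> C) (c : C) (r : R) (p : C) :
  open_disc c r p -> C_continuous_on (open_disc c r) f ->
  holomorphic_on (fun z => open_disc c r z /\ z <> p) f -> holomorphic_on (open_disc c r) f.
Proof.
  intros Dp Cf Hol z Dz.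
  assert (HF := disc_primitive c p r f Dp Cf Hol).
  assert (HolF : holomorphic_on (open_disc c r) (segment_int f p)).
  { intros w Dw. exists (f w). now apply HF. }
  destruct (holomorphic_on_Cderiv_disc _ c r HolF z Dz) as [l Hl].
  exists l. apply (is_C_derive_ext_loc (Cderiv (segment_int f p))); [|exact Hl].
  generalize (locally_open_disc c z r Dz). apply filter_imp. intros w Dw.
  now apply is_C_derive_Cderiv, HF.
Qed.

Lemma le_of_pow_le_mult_pow (x M A : R) : 0 <= M -> (forall n, x ^ n <= A * M ^ n) -> x <= M.
Proof.
  intros HM H. apply Rnot_lt_le. intros Hx.
  destruct (pow_lt_1_zero (M / x)) with (y := / (Rabs A + 1)) as [N HN].
  - rewrite Rabs_pos_eq by (apply Rdiv_le_0_compat; lra). apply Rlt_div_l; lra.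
  - apply Rinv_0_lt_compat. generalize (Rabs_pos A). lra.
  - specialize (HN N (Nat.le_refl N)). specialize (H N).
    assert (HA : 0 < Rabs A + 1) by (generalize (Rabs_pos A); lra).
    assert (Hxn : 0 < x ^ N) by (apply pow_lt; lra).
    assert (HMn : 0 <= M ^ N) by now apply pow_le.
    unfold Rdiv in HN. rewrite Rpow_mult_distr, pow_inv in HN.
    rewrite Rabs_pos_eq in HN by (apply Rdiv_le_0_compat; lra).
    apply Rlt_div_l in HN; [|exact Hxn].
    apply (Rmult_lt_compat_l (Rabs A + 1)) in HN; [|exact HA].
    rewrite <- Rmult_assoc, Rinv_r, Rmult_1_l in HN by lra.
    generalize (Rle_abs A). nra.
Qed.

(* Cauchy's formula for [f ^ n] bounds [|f a| ^ n] by [A * M ^ n] with [A] independent of [n]. *)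
Theorem maximum_principle (f : C -> C) (c : C) (r r' M : R) (a : C) :
  holomorphic_on (open_disc c r') f -> r < r' -> open_disc c r a ->
  (forall t, Cmod (f (circle c r t)) <= M) -> Cmod (f a) <= M.
Proof.
  intros Hol Hr' Ha HM.
  assert (Hr := open_disc_radius_pos c a r Ha).
  assert (HM0 : 0 <= M) by (eapply Rle_trans; [apply Cmod_ge_0|apply (HM 0)]).
  set (d := r - Cmod (a - c)%C). assert (Hd : 0 < d) by (unfold d, open_disc in *; lra).
  apply le_of_pow_le_mult_pow with (/ d * r); [exact HM0|]. intros n.
  assert (Holn := holomorphic_on_pow _ f n Hol).
  assert (Cfn := continuous_on_circle_disc _ c r r' ltac:(lra)
    (holomorphic_on_continuous _ _ Holn)).
  apply Rmult_le_reg_l with (2 * PI); [generalize PI_RGT_0; lra|].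
  replace (2 * PI * Cmod (f a) ^ n) with (Cmod (RtoC (2 * PI) * Ci * f a ^ n)%C).
  - rewrite <- (cauchy_formula (fun z => f z ^ n)%C c r r' a Holn Hr' Ha).
    replace (2 * PI * (/ d * r * M ^ n)) with (2 * PI * (M ^ n * / d * r)) by ring.
    apply circle_int_norm_le; [exact Hr|now apply continuous_on_circle_inv_pow|].
    intros t _. simpl. rewrite Cmult_1_r, Cmod_mult, Cmod_pow.
    apply Rmult_le_compat; auto using Cmod_ge_0, pow_le.
    + apply pow_incr. auto using Cmod_ge_0.
    + rewrite Cmod_inv by now apply circle_neq.
      apply Rinv_le_contravar; [exact Hd|]. apply dist_circle_ge. lra.
  - rewrite !Cmod_mult, Cmod_Ci, Cmod_R, Cmod_pow, Rabs_pos_eq; [ring|].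
    generalize PI_RGT_0. lra.
Qed.

(** * Holomorphic functions on the unit disc *)

Lemma in_disk_open_disc (z : C) : in_disk z <-> open_disc (RtoC 0) 1 z.
Proof. unfold in_disk, open_disc. now replace (z - 0)%C with z by ring. Qed.

Lemma in_disk_0 : in_disk (RtoC 0).
Proof. apply in_disk_open_disc, open_disc_center. lra. Qed.

Lemma locally_in_disk (z : C) : in_disk z -> locally (T := CU) z in_disk.
Proof.
  intros Hz. generalize (locally_open_disc (RtoC 0) z 1 (proj1 (in_disk_open_disc z) Hz)).
  apply filter_imp. intros w. apply in_disk_open_disc.
Qed.

Lemma is_C_derive_ext_in_disk (f g : C -> C) (z l : C) : in_disk z ->
  (forall w, in_disk w -> f w = g w) -> is_C_derive f z l -> is_C_derive g z l.
Proof.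
  intros Hz E. apply is_C_derive_ext_loc. generalize (locally_in_disk z Hz). now apply filter_imp.
Qed.

Lemma holomorphic_in_disk_open_disc (f : C -> C) :
  holomorphic_on in_disk f <-> holomorphic_on (open_disc (RtoC 0) 1) f.
Proof. split; apply holomorphic_on_subset; intros z; apply in_disk_open_disc. Qed.

Lemma holomorphic_in_disk_primitive (f : C -> C) (z : C) :
  holomorphic_on in_disk f -> in_disk z -> is_C_derive (segment_int f (RtoC 0)) z (f z).
Proof.
  rewrite holomorphic_in_disk_open_disc, in_disk_open_disc. intros Hf Hz.
  apply (disc_primitive (RtoC 0) (RtoC 0) 1); [|now apply holomorphic_on_continuous| |exact Hz].
  - apply open_disc_center. lra.
  - apply (holomorphic_on_subset (open_disc (RtoC 0) 1)); [tauto|exact Hf].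
Qed.

Lemma holomorphic_in_disk_Cderiv (f : C -> C) :
  holomorphic_on in_disk f -> holomorphic_on in_disk (Cderiv f).
Proof. rewrite !holomorphic_in_disk_open_disc. apply holomorphic_on_Cderiv_disc. Qed.

Lemma holomorphic_div_id (f : C -> C) : holomorphic_on in_disk f -> f (RtoC 0) = RtoC 0 ->
  exists g, holomorphic_on in_disk g /\ forall z, f z = (z * g z)%C.
Proof.
  intros Hol Hf0. apply holomorphic_in_disk_open_disc in Hol.
  assert (disc_0 : open_disc (RtoC 0) 1 (RtoC 0)) by (apply open_disc_center; lra).
  destruct (exists_slope_function f (RtoC 0) 1 (RtoC 0) Hol disc_0) as [g [Cg [Hg Eg]]].
  exists g. split.
  - apply holomorphic_in_disk_open_disc. now apply (holomorphic_on_removable g (RtoC 0) 1 (RtoC 0)).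
  - intros z. rewrite (Eg z), Hf0. ring.
Qed.

Lemma schwarz_lemma_quotient (k : C -> C) (a : C) :
  holomorphic_on in_disk k -> (forall z, in_disk z -> Cmod (z * k z)%C <= 1) ->
  in_disk a -> Cmod (k a) <= 1.
Proof.
  intros Hk Hle Ha. apply Rnot_lt_le. intros Hgt. unfold in_disk in Ha.
  assert (Hinv : / Cmod (k a) < 1) by (rewrite <- Rinv_1; apply Rinv_lt_contravar; lra).
  assert (Hmax := Rmax_lub_lt _ _ _ Ha Hinv).
  set (r := (1 + Rmax (Cmod a) (/ Cmod (k a))) / 2).
  assert (Hr : Rmax (Cmod a) (/ Cmod (k a)) < r < 1) by (unfold r; lra).
  assert (Har := Rle_lt_trans _ _ _ (Rmax_l _ _) (proj1 Hr)).
  assert (Hkr := Rle_lt_trans _ _ _ (Rmax_r _ _) (proj1 Hr)).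
  assert (Hr0 : 0 < r) by (generalize (Cmod_ge_0 a); lra).
  assert (Hka : Cmod (k a) <= / r).
  { apply (maximum_principle k (RtoC 0) r 1).
    - now apply holomorphic_in_disk_open_disc.
    - tauto.
    - unfold open_disc. now replace (a - 0)%C with a by ring.
    - intros t. apply Rmult_le_reg_l with r; [exact Hr0|]. rewrite Rinv_r by lra.
      assert (Ht : in_disk (circle (RtoC 0) r t)).
      { apply in_disk_open_disc, circle_in_open_disc. lra. }
      generalize (Hle _ Ht) (Cmod_circle_minus_center (RtoC 0) r t ltac:(lra)).
      replace (circle 0 r t - 0)%C with (circle 0 r t) by ring. rewrite Cmod_mult.
      intros Hk1 Er. now rewrite Er in Hk1. }
  apply (Rlt_irrefl (/ r)). apply Rlt_le_trans with (Cmod (k a)); [|exact Hka].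
  rewrite <- (Rinv_inv (Cmod (k a))). apply Rinv_lt_contravar; [|exact Hkr].
  apply Rmult_lt_0_compat; [apply Rinv_0_lt_compat; lra|exact Hr0].
Qed.

Lemma Cmod_le_Cmod_add_double (w : C) (b : R) : 0 <= b -> - b <= Re w ->
  Cmod w <= Cmod (RtoC (2 * b) + w)%C.
Proof.
  intros Hb Hw. apply Rsqr_incr_0; try apply Cmod_ge_0. unfold Rsqr.
  generalize (Cmod2_alt w) (Cmod2_alt (RtoC (2 * b) + w)%C).
  rewrite re_plus, im_plus.
  change (Re (RtoC (2 * b))) with (2 * b). change (Im (RtoC (2 * b))) with 0.
  nra.
Qed.

(* [k z = s z / (2 b + z * s z)] satisfies Schwarz's lemma, and [s a (1 - a * k a) = 2 b * k a]. *)
Lemma borel_caratheodory_quotient (s : C -> C) (b : R) (a : C) :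
  holomorphic_on in_disk s -> 0 < b -> (forall z, in_disk z -> - b < Re (z * s z)%C) ->
  in_disk a -> Cmod (s a) * (1 - Cmod a) <= 2 * b.
Proof.
  intros Hs Hb HRe Ha.
  assert (Nden : forall z, in_disk z -> (RtoC (2 * b) + z * s z)%C <> RtoC 0).
  { intros z Hz E. apply (f_equal Re) in E. rewrite re_plus in E. simpl (Re (RtoC _)) in E.
    generalize (HRe z Hz). lra. }
  set (k z := (s z * / (RtoC (2 * b) + z * s z))%C).
  assert (Hk : Cmod (k a) <= 1).
  { apply schwarz_lemma_quotient; [| |exact Ha].
    - apply holomorphic_on_mult; [exact Hs|]. apply holomorphic_on_inv; [|exact Nden].
      apply holomorphic_on_plus; [apply holomorphic_on_const|].
      apply holomorphic_on_mult; [apply holomorphic_on_id|exact Hs].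
    - intros z Hz.
      replace (z * k z)%C with ((z * s z) / (RtoC (2 * b) + z * s z))%C by (unfold k, Cdiv; ring).
      rewrite Cmod_div by auto. apply Rle_div_l; [now apply Cmod_gt_0, Nden|].
      rewrite Rmult_1_l. apply Cmod_le_Cmod_add_double; [lra|]. left. now apply HRe. }
  assert (E : Cmod (s a) * Cmod (1 - a * k a)%C = 2 * b * Cmod (k a)).
  { rewrite <- (Rabs_pos_eq (2 * b)), <- Cmod_R, <- !Cmod_mult by lra. f_equal.
    unfold k. field. now apply Nden. }
  assert (Hlow := Cmod_triangle_rev (RtoC 1) (a * k a)%C). rewrite Cmod_1, Cmod_mult in Hlow.
  assert (Ha0 := Cmod_ge_0 a). assert (Hs0 := Cmod_ge_0 (s a)). unfold in_disk in Ha.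
  assert (Hone : 1 - Cmod a <= Cmod (1 - a * k a)%C) by nra.
  apply Rle_trans with (Cmod (s a) * Cmod (1 - a * k a)%C); [|nra].
  now apply Rmult_le_compat_l.
Qed.

(** * The Alexander transform *)

Section Quotient.

Variables (f g : C -> C).
Hypothesis holomorphic_g : holomorphic_on in_disk g.
Hypothesis f_eq : forall z, in_disk z -> f z = (z * g z)%C.

Lemma alexander_segment_int (z : C) : in_disk z -> segment_int g (RtoC 0) z = alexander f z.
Proof.
  intros Hz. apply C_RInt_ext. rewrite Rmin_left, Rmax_right by lra. intros t Ht.
  unfold segment. replace (0 + t * (z - 0))%C with (t * z)%C by ring.
  replace (z - 0)%C with z by ring.
  destruct (Ceq_dec z (RtoC 0)) as [-> | Nz]; [now rewrite !Cmult_0_r|].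
  assert (Nt : RtoC t <> RtoC 0) by (intros E; apply RtoC_inj in E; lra).
  rewrite f_eq.
  - generalize (g (t * z)%C). intros w. field. auto.
  - unfold in_disk in *. rewrite Cmod_mult, Cmod_R, Rabs_pos_eq by lra.
    generalize (Cmod_ge_0 z). nra.
Qed.

Lemma is_C_derive_alexander (z : C) : in_disk z -> is_C_derive (alexander f) z (g z).
Proof.
  intros Hz. apply (is_C_derive_ext_in_disk (segment_int g (RtoC 0)) _ z _ Hz).
  - exact alexander_segment_int.
  - now apply holomorphic_in_disk_primitive.
Qed.

Lemma preschwarzian_alexander (z : C) : in_disk z ->
  Cdiv (Cderiv (Cderiv (alexander f)) z) (Cderiv (alexander f) z) = (Cderiv g z / g z)%C.
Proof.
  intros Hz.
  assert (E : forall w, in_disk w -> Cderiv (alexander f) w = g w).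
  { intros w Hw. now apply is_C_derive_Cderiv, is_C_derive_alexander. }
  rewrite (E z Hz). f_equal. apply is_C_derive_Cderiv.
  apply (is_C_derive_ext_in_disk g _ z _ Hz).
  - intros w Hw. now rewrite E.
  - now apply (holomorphic_on_Cderiv in_disk).
Qed.

Lemma is_C_derive_mul_id (z : C) : in_disk z -> is_C_derive f z (g z + z * Cderiv g z)%C.
Proof.
  intros Hz. apply (is_C_derive_ext_in_disk (fun w => w * g w)%C _ z _ Hz).
  - intros w Hw. now rewrite f_eq.
  - eapply is_C_derive_eq.
    + apply is_C_derive_mult; [apply is_C_derive_id|now apply (holomorphic_on_Cderiv in_disk)].
    + cbv beta. ring.
Qed.

Lemma Re_spirallike_quotient (alpha : R) (z : C) : in_disk z -> z <> RtoC 0 -> g z <> RtoC 0 ->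
  Re (cexpi alpha * (z * Cderiv f z / f z))%C =
  cos alpha + Re (z * (cexpi alpha * (Cderiv g z / g z)))%C.
Proof.
  intros Hz Nz Ng. change (cos alpha) with (Re (cexpi alpha)). rewrite <- re_plus. f_equal.
  rewrite (is_C_derive_Cderiv _ _ _ (is_C_derive_mul_id z Hz)), f_eq by exact Hz.
  field. auto.
Qed.

Lemma Sstar_mul_id (alpha lam : R) : 0 < (1 - lam) * cos alpha ->
  Sstar alpha lam f <->
  g (RtoC 0) = RtoC 1 /\ forall z, in_disk z -> g z <> RtoC 0 /\
    - ((1 - lam) * cos alpha) < Re (z * (cexpi alpha * (Cderiv g z / g z)))%C.
Proof.
  intros Hpos.
  assert (Hf'0 : Cderiv f (RtoC 0) = g (RtoC 0)).
  { rewrite (is_C_derive_Cderiv _ _ _ (is_C_derive_mul_id _ in_disk_0)). ring. }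
  split.
  - intros [[_ [_ Hf'1]] [Nf HRe]]. rewrite Hf'0 in Hf'1. split; [exact Hf'1|]. intros z Hz.
    destruct (Ceq_dec z (RtoC 0)) as [-> | Nz].
    + rewrite Hf'1, Cmult_0_l. split; [exact C1_nz|]. simpl. lra.
    + assert (Ng : g z <> RtoC 0).
      { intros E. apply (Nf z Hz Nz). rewrite (f_eq z Hz), E. ring. }
      split; [exact Ng|]. generalize (HRe z Hz Nz). rewrite Re_spirallike_quotient by auto. lra.
  - intros [Hg0 HRe]. split; [split; [|split]|split].
    + intros z Hz. exists (g z + z * Cderiv g z)%C.
      now apply is_C_derive_NormedModule, is_C_derive_mul_id.
    + rewrite f_eq by exact in_disk_0. ring.
    + now rewrite Hf'0.
    + intros z Hz Nz. rewrite f_eq by exact Hz. apply Cmult_neq_0; [exact Nz|now apply HRe].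
    + intros z Hz Nz. destruct (HRe z Hz) as [Ng Hg]. rewrite Re_spirallike_quotient by auto. lra.
Qed.

End Quotient.

Lemma Sstar_exists_quotient (alpha lam : R) (f : C -> C) : Sstar alpha lam f ->
  exists g, holomorphic_on in_disk g /\ forall z, f z = (z * g z)%C.
Proof.
  intros [[Hf [Hf0 _]] _]. apply holomorphic_div_id; [|exact Hf0].
  intros z Hz. destruct (Hf z Hz) as [l Hl]. exists l. now apply is_C_derive_NormedModule.
Qed.

Lemma preschwarzian_norm_alexander_le (alpha lam : R) (f : C -> C) :
  0 < (1 - lam) * cos alpha -> Sstar alpha lam f ->
  Rbar_le (preschwarzian_norm (alexander f)) (Finite (4 * (1 - lam) * cos alpha)).
Proof.
  intros Hpos HS. destruct (Sstar_exists_quotient alpha lam f HS) as [g [Hg Efg]].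
  assert (Eg : forall z, in_disk z -> f z = (z * g z)%C) by auto.
  destruct (proj1 (Sstar_mul_id f g Hg Eg alpha lam Hpos) HS) as [_ HRe].
  set (s z := (cexpi alpha * (Cderiv g z * / g z))%C).
  assert (Hs : holomorphic_on in_disk s).
  { apply holomorphic_on_mult; [apply holomorphic_on_const|]. apply holomorphic_on_mult.
    - now apply holomorphic_in_disk_Cderiv.
    - apply holomorphic_on_inv; [exact Hg|apply HRe]. }
  apply (proj2 (Lub_Rbar_correct _)). intros x [z [Hz ->]].
  rewrite (preschwarzian_alexander f g Hg Eg z Hz).
  replace (Cmod (Cderiv g z / g z)%C) with (Cmod (s z))
    by (unfold s; now rewrite Cmod_mult, Cmod_cexpi, Rmult_1_l).
  assert (Hbound := borel_caratheodory_quotient s _ z Hs Hpos (fun w Hw => proj2 (HRe w Hw)) Hz).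
  unfold in_disk in Hz. assert (Hz0 := Cmod_ge_0 z). simpl.
  set (b := (1 - lam) * cos alpha) in *.
  replace (4 * (1 - lam) * cos alpha) with (2 * b * 2) by (unfold b; ring).
  replace ((1 - Cmod z * (Cmod z * 1)) * Cmod (s z))
    with (Cmod (s z) * (1 - Cmod z) * (1 + Cmod z)) by ring.
  apply Rmult_le_compat; [|lra|exact Hbound|lra].
  apply Rmult_le_pos; [apply Cmod_ge_0|lra].
Qed.

(** * The extremal function *)

Lemma continuous_comp_Re (u : R -> C) (z : C) :
  C_continuous u (Re z) -> @continuous CU CU (fun w => u (Re w)) z.
Proof.
  apply (@continuous_comp CU R_UniformSpace CU).
  apply (C_continuous_Re (T := CU) (fun w => w)), continuous_id.
Qed.

Lemma continuous_comp_Im (v : R -> C) (z : C) :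
  C_continuous v (Im z) -> @continuous CU CU (fun w => v (Im w)) z.
Proof.
  apply (@continuous_comp CU R_UniformSpace CU).
  apply (C_continuous_Im (T := CU) (fun w => w)), continuous_id.
Qed.

Definition cexp (z : C) : C := (RtoC (exp (Re z)) * cexpi (Im z))%C.

(* The last hypothesis is the Cauchy-Riemann equation. *)
Lemma is_C_derive_separated (u v : R -> C) (z du dv : C) :
  is_curve_derive u (Re z) du -> is_curve_derive v (Im z) dv ->
  (Ci * (du * v (Im z)))%C = (u (Re z) * dv)%C ->
  is_C_derive (fun w => u (Re w) * v (Im w))%C z (du * v (Im z))%C.
Proof.
  intros Hu Hv CR. assert (Cv := is_curve_derive_continuous v _ _ Hv).
  apply is_curve_derive_slope in Hu, Hv.
  destruct Hu as [phi [Cphi [<- Eu]]], Hv as [psi [Cpsi [<- Ev]]].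
  set (slope_re w := (phi (Re w) * v (Im w))%C).
  set (slope_im w := (u (Re z) * psi (Im w))%C).
  assert (Cre : @continuous CU CU slope_re z).
  { apply (C_continuous_mult (T := CU)); [now apply continuous_comp_Re|].
    now apply continuous_comp_Im. }
  assert (Cim : @continuous CU CU slope_im z).
  { apply (C_continuous_mult (T := CU)); [apply (C_continuous_const (T := CU))|].
    now apply continuous_comp_Im. }
  apply is_C_derive_iff. intros eps.
  assert (He : 0 < eps / 2) by (generalize (cond_pos eps); lra).
  generalize (filter_and _ _
    (proj1 (C_continuous_iff (T := CU) slope_re z) Cre (mkposreal _ He))
    (proj1 (C_continuous_iff (T := CU) slope_im z) Cim (mkposreal _ He))).
  apply filter_imp. simpl. intros w [Hre Him].
  set (dx := (RtoC (Re w) - RtoC (Re z))%C). set (dy := (RtoC (Im w) - RtoC (Im z))%C).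
  assert (Ewz : (w - z)%C = (dx + Ci * dy)%C).
  { rewrite (C_eq_Re_Im w), (C_eq_Re_Im z) at 1. unfold dx, dy. ring. }
  assert (Ere : u (Re w) = (u (Re z) + dx * phi (Re w))%C) by apply Eu.
  assert (Eim : v (Im w) = (v (Im z) + dy * psi (Im w))%C) by apply Ev.
  replace (u (Re w) * v (Im w) - u (Re z) * v (Im z) - (w - z) * (phi (Re z) * v (Im z)))%C
    with (dx * (slope_re w - slope_re z) + dy * (slope_im w - slope_im z))%C.
  - assert (Hdx : Cmod dx <= Cmod (w - z)%C).
    { unfold dx. rewrite <- RtoC_minus, Cmod_R. exact (re_le_Cmod (w - z)%C). }
    assert (Hdy : Cmod dy <= Cmod (w - z)%C).
    { unfold dy. rewrite <- RtoC_minus, Cmod_R. exact (im_le_Cmod (w - z)%C). }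
    eapply Rle_trans; [apply Cmod_triangle|]. rewrite !Cmod_mult.
    replace (eps * Cmod (w - z)%C) with (Cmod (w - z)%C * (eps / 2) + Cmod (w - z)%C * (eps / 2))
      by field.
    apply Rplus_le_compat; apply Rmult_le_compat; auto using Cmod_ge_0, Rlt_le.
  - unfold slope_re, slope_im. rewrite Ewz.
    transitivity (u (Re w) * v (Im w) - u (Re z) * v (Im z) - dx * (phi (Re z) * v (Im z))
      - dy * (Ci * (phi (Re z) * v (Im z))))%C; [|ring].
    rewrite CR, Ere, Eim. ring.
Qed.

Lemma is_C_derive_cexp (z : C) : is_C_derive cexp z (cexp z).
Proof.
  apply (is_C_derive_separated (fun x => RtoC (exp x)) cexpi z (RtoC (exp (Re z)))
    (Ci * cexpi (Im z))).
  - apply (is_curve_derive_pair exp (fun _ => 0)); [apply is_derive_exp|].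
    apply (is_derive_const (V := R_NormedModule)).
  - apply is_curve_derive_cexpi.
  - ring.
Qed.

Lemma cexp_neq_0 (z : C) : cexp z <> RtoC 0.
Proof.
  apply Cmod_gt_0. unfold cexp. rewrite Cmod_mult, Cmod_cexpi, Cmod_R, Rmult_1_r.
  apply Rabs_pos_lt. generalize (exp_pos (Re z)). lra.
Qed.

Lemma cexp_0 : cexp (RtoC 0) = RtoC 1.
Proof.
  unfold cexp, cexpi. simpl. rewrite exp_0, cos_0, sin_0. unfold Cmult, RtoC. simpl. f_equal; ring.
Qed.

Lemma cexpi_opp_r (t : R) : (cexpi t * cexpi (- t))%C = RtoC 1.
Proof.
  unfold cexpi, Cmult, RtoC. simpl. rewrite cos_neg, sin_neg.
  f_equal; [|ring]. generalize (sin2_cos2 t). unfold Rsqr. lra.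
Qed.

Lemma one_minus_neq_0 (z : C) : in_disk z -> (1 - z)%C <> RtoC 0.
Proof.
  unfold in_disk. intros Hz. apply Cmod_gt_0.
  generalize (Cmod_triangle_rev (RtoC 1) z). rewrite Cmod_1. lra.
Qed.

(* The principal branch of [(1 - z) ^ (- c)]; the integral is [- log (1 - z)]. *)
Definition one_minus_pow_opp (c z : C) : C :=
  cexp (c * segment_int (fun w => / (1 - w)) (RtoC 0) z)%C.

Lemma is_C_derive_one_minus_pow_opp (c z : C) : in_disk z ->
  is_C_derive (one_minus_pow_opp c) z (one_minus_pow_opp c z * (c / (1 - z)))%C.
Proof.
  intros Hz.
  apply (is_C_derive_comp cexp (fun w => c * segment_int (fun w => / (1 - w)) (RtoC 0) w)%C);
    [apply is_C_derive_cexp|].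
  apply is_C_derive_scal, (holomorphic_in_disk_primitive (fun w => / (1 - w))%C); [|exact Hz].
  apply (holomorphic_on_inv _ (fun w => 1 - w)%C); [|exact one_minus_neq_0].
  intros w _. eexists. apply is_C_derive_minus; [apply is_C_derive_const|apply is_C_derive_id].
Qed.

Lemma one_minus_pow_opp_0 (c : C) : one_minus_pow_opp c (RtoC 0) = RtoC 1.
Proof. unfold one_minus_pow_opp. rewrite segment_int_refl, Cmult_0_r. exact cexp_0. Qed.

Lemma holomorphic_one_minus_pow_opp (c : C) : holomorphic_on in_disk (one_minus_pow_opp c).
Proof. intros z Hz. eexists. now apply is_C_derive_one_minus_pow_opp. Qed.

Lemma log_derivative_one_minus_pow_opp (c z : C) : in_disk z ->
  (Cderiv (one_minus_pow_opp c) z / one_minus_pow_opp c z)%C = (c / (1 - z))%C.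
Proof.
  intros Hz. rewrite (is_C_derive_Cderiv _ _ _ (is_C_derive_one_minus_pow_opp c z Hz)).
  field. split; [now apply one_minus_neq_0|apply cexp_neq_0].
Qed.

(* With [w = z / (1 - z)] one has [z = w / (1 + w)], so [|z| < 1] means [|w| < |1 + w|]. *)
Lemma Re_div_one_minus_gt (z : C) : in_disk z -> - / 2 < Re (z / (1 - z))%C.
Proof.
  intros Hz. assert (N := one_minus_neq_0 z Hz). unfold in_disk in Hz.
  set (w := (z / (1 - z))%C).
  assert (Hw : Cmod w < Cmod (1 + w)%C).
  { replace (1 + w)%C with (/ (1 - z))%C by (unfold w; field; exact N).
    unfold w, Cdiv. rewrite Cmod_mult, Cmod_inv by exact N.
    rewrite <- (Rmult_1_l (/ _)) at 2. apply Rmult_lt_compat_r; [|exact Hz].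
    now apply Rinv_0_lt_compat, Cmod_gt_0. }
  assert (Hsq : Cmod w ^ 2 < Cmod (1 + w)%C ^ 2).
  { generalize (Cmod_ge_0 w). simpl. nra. }
  rewrite !Cmod2_alt, re_plus, im_plus in Hsq.
  change (Re (RtoC 1)) with 1 in Hsq. change (Im (RtoC 1)) with 0 in Hsq.
  nra.
Qed.

Definition spirallike_extremal (alpha lam : R) (z : C) : C :=
  (z * one_minus_pow_opp (RtoC (2 * ((1 - lam) * cos alpha)) * cexpi (- alpha)) z)%C.

Lemma Sstar_spirallike_extremal (alpha lam : R) : 0 < (1 - lam) * cos alpha ->
  Sstar alpha lam (spirallike_extremal alpha lam).
Proof.
  intros Hpos. set (b := (1 - lam) * cos alpha) in *.
  set (c := (RtoC (2 * b) * cexpi (- alpha))%C).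
  apply (Sstar_mul_id _ (one_minus_pow_opp c) (holomorphic_one_minus_pow_opp c));
    [reflexivity|exact Hpos|].
  split; [apply one_minus_pow_opp_0|]. intros z Hz. split; [apply cexp_neq_0|].
  assert (N := one_minus_neq_0 z Hz).
  rewrite log_derivative_one_minus_pow_opp by exact Hz.
  replace (z * (cexpi alpha * (c / (1 - z))))%C with (RtoC (2 * b) * (z / (1 - z)))%C.
  - rewrite re_scal_l. fold b. generalize (Re_div_one_minus_gt z Hz). nra.
  - transitivity (RtoC (2 * b) * (z / (1 - z)) * (cexpi alpha * cexpi (- alpha)))%C.
    + rewrite cexpi_opp_r. ring.
    + unfold c. field. exact N.
Qed.

Lemma preschwarzian_norm_spirallike_extremal_ge (alpha lam x : R) : 0 < (1 - lam) * cos alpha ->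
  0 <= x < 1 ->
  Rbar_le (Finite (2 * ((1 - lam) * cos alpha) * (1 + x)))
    (preschwarzian_norm (alexander (spirallike_extremal alpha lam))).
Proof.
  intros Hpos Hx. set (b := (1 - lam) * cos alpha) in *.
  set (c := (RtoC (2 * b) * cexpi (- alpha))%C).
  assert (Dx : in_disk (RtoC x)) by (unfold in_disk; rewrite Cmod_R, Rabs_pos_eq; lra).
  apply (proj1 (Lub_Rbar_correct _)). exists (RtoC x). split; [exact Dx|].
  rewrite (preschwarzian_alexander (spirallike_extremal alpha lam) (one_minus_pow_opp c)
    (holomorphic_one_minus_pow_opp c) (fun _ _ => eq_refl) (RtoC x) Dx).
  rewrite log_derivative_one_minus_pow_opp by exact Dx.
  rewrite Cmod_div by now apply one_minus_neq_0.
  unfold c. rewrite Cmod_mult, Cmod_cexpi, <- RtoC_minus, !Cmod_R, !Rabs_pos_eq by lra.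
  field. lra.
Qed.

Lemma Rbar_le_of_mult_one_plus_le (k : R) (L : Rbar) : 0 < k ->
  (forall x, 0 <= x < 1 -> Rbar_le (Finite (k * (1 + x))) L) -> Rbar_le (Finite (k * 2)) L.
Proof.
  intros Hk HL. destruct L as [l| |]; [|exact I|exact (HL 0 ltac:(lra))].
  simpl in *. apply le_epsilon. intros eps He.
  assert (Hd : 0 < Rmin 1 (eps / k)) by (apply Rmin_pos; [lra|now apply Rdiv_lt_0_compat]).
  assert (Hd1 := Rmin_l 1 (eps / k)). assert (Hdk := Rmin_r 1 (eps / k)).
  set (d := Rmin 1 (eps / k)) in *. apply Rle_div_r in Hdk; [|exact Hk].
  assert (Hx := HL (1 - d) ltac:(lra)). lra.
Qed.

Theorem theorem3p2 (alpha lam : R) :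
  - (PI / 2) < alpha < PI / 2 -> lam < 1 ->
  (forall f : C -> C, Sstar alpha lam f ->
     Rbar_le (preschwarzian_norm (alexander f)) (Finite (4 * (1 - lam) * cos alpha))) /\
  (exists f : C -> C, Sstar alpha lam f /\
     preschwarzian_norm (alexander f) = Finite (4 * (1 - lam) * cos alpha)).
Proof.
  intros Halpha Hlam.
  assert (Hpos : 0 < (1 - lam) * cos alpha).
  { apply Rmult_lt_0_compat; [lra|]. now apply cos_gt_0. }
  split; [intros f; now apply preschwarzian_norm_alexander_le|].
  assert (HS := Sstar_spirallike_extremal alpha lam Hpos).
  exists (spirallike_extremal alpha lam). split; [exact HS|].
  apply Rbar_le_antisym; [now apply preschwarzian_norm_alexander_le|].
  replace (4 * (1 - lam) * cos alpha) with (2 * ((1 - lam) * cos alpha) * 2) by ring.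
  apply Rbar_le_of_mult_one_plus_le; [lra|].
  intros x. now apply preschwarzian_norm_spirallike_extremal_ge.
Qed.
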